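(* Let $f\colon P\to Q$ and $\phi\colon R\to Q^*$ be monotone maps of finite posets. Consider the following diagram consisting of three pullback squares: $$\begin{array}{ccccc} Z&\xrightarrow{\ h\ }&Y&\xrightarrow{\ \bar\rho_Y\ }&R\\ {\scriptstyle\chi}\downarrow&&{\scriptstyle\psi}\downarrow&&\downarrow{\scriptstyle\phi}\\ X&\xrightarrow{\ g\ }&h(Q)&\xrightarrow{\ \bar r_Q\ }&Q^*\\ {\scriptstyle\rho_X}\downarrow&&{\scriptstyle r_Q}\downarrow&&\\ P&\xrightarrow{\ f\ }&Q&& \end{array}$$ Then $r_Q$, $\bar r_Q$, $\rho_X$ and $\bar\rho_Y$, as well as both vertical compositions $\rho_X\chi\colon Z\to P$ and $r_Q\psi\colon Y\to Q$ and both horizontal compositions $\bar\rho_Yh\colon Z\to R$ and $\bar r_Qg\colon X\to Q^*$, are cubical. If $f$ is a stratification map [resp. a subdivision map], then so are $g$ and $h$; and if $\phi$ is a stratification map [resp. a subdivision map], then so are $\psi$ and $\chi$.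
   Context: All posets are finite; homeomorphisms of polyhedra are PL. $P^*$ is $P$ with the opposite order; $p^*$ is $p$ viewed in $P^*$. For $p\in P$: $\lceil p\rceil=\{x\le p\}$, $\partial\lceil p\rceil=\{x<p\}$, $\mathrm{lk}(p,P)=\{x>p\}$. $|P|$ is the polyhedron given by the geometric realization of the simplicial complex of nonempty chains of $P$. $CX$ is $X$ with a greatest element adjoined; products of posets have the product order; the pullback of monotone maps $A\to C\leftarrow B$ is the subposet of $A\times B$ of pairs having the same image in $C$. For a poset $Q$, $Q^\#$ is the poset of all intervals $[\sigma,\tau]=\{x:\sigma\le x\le\tau\}$ ($\sigma\le\tau$ in $Q$) ordered by inclusion, and $h(Q)=(Q^\#)^*$ (the notation $h(Q)$ is unrelated to the map $h$). The monotone maps $r_Q\colon h(Q)\to Q$ and $\bar r_Q\colon h(Q)\to Q^*$ are given by $r_Q([\sigma,\tau]^* )=\sigma$ and $\bar r_Q([\sigma,\tau]^* )=\tau^*$. A monotone map $g\colon A\to B$ is cubical if for every $a\in A$ the restriction $\lceil a\rceil\to\lceil g(a)\rceil$ of $g$ is isomorphic to the projection $CV\times CW\to CV$ for some posets $V,W$. A subdivision map is a monotone map $g\colon A\to B$ such that for each $b\in B$, $|g^{-1}(\lceil b\rceil)|$ is homeomorphic to $|Cg^{-1}(\partial\lceil b\rceil)|$ keeping $|g^{-1}(\partial\lceil b\rceil)|$ fixed. A subposet $D\subset A$ is closed if $a\le d\in D$ implies $a\in D$; a closed subposet $D$ of $A$ is collared in $A$ if for every $d\in D$, $|\mathrm{lk}(d,A)|$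 is homeomorphic to the cone over $|\mathrm{lk}(d,D)|$ keeping $|\mathrm{lk}(d,D)|$ fixed (the cone over $\emptyset$ is a point). A stratification map is a monotone map $g\colon A\to B$ such that $g^{-1}(\partial\lceil b\rceil)$ is collared in $g^{-1}(\lceil b\rceil)$ for each $b\in B$. *)

(* Defs.v *)
From HB Require Import structures.
From mathcomp Require Import all_boot all_order all_algebra.
From mathcomp Require Import classical_sets reals.

Set Warnings "-redundant-canonical-projection,-projection-no-head-constant".

Set Implicit Arguments.
Unset Strict Implicit.
Unset Printing Implicit Defensive.

Import Order.TTheory GRing.Theory Num.Theory.
Local Open Scope order_scope.

Definition monotone d d' (A : porderType d) (B : porderType d') (g : A -> B) :=
  {homo g : x y / x <= y}.

(** * Constructions on finite posets *)

(* [None] is the adjoined greatest element. *)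
Definition cone (T : Type) : Type := option T.

HB.instance Definition _ (T : finType) := Finite.copy (cone T) (option T).

Section ConeOrder.
Context (d : Order.disp_t) (A : finPOrderType d).

Definition cone_le (x y : cone A) : bool :=
  match x, y with
  | _, None => true
  | None, Some _ => false
  | Some a, Some b => a <= b
  end.

Lemma cone_le_refl : reflexive cone_le.
Proof. by case=> /=. Qed.

Lemma cone_le_anti : antisymmetric cone_le.
Proof. by case=> [a|] [b|] //= /le_anti ->. Qed.

Lemma cone_le_trans : transitive cone_le.
Proof. by case=> [b|] [a|] [c|] //=; apply: le_trans. Qed.

HB.instance Definition _ :=
  Order.Le_isPOrder.Build d (cone A) cone_le_refl cone_le_anti cone_le_trans.

End ConeOrder.

(* The poset Q^#.  A nonempty interval is recorded by its endpoints, which it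
   determines; the order is inclusion of intervals as subsets of Q. *)
Section IntervalOrder.
Context (d : Order.disp_t) (Q : finPOrderType d).

Record intervals : Type := Interval {
  itv_ends : Q * Q;
  _ : itv_ends.1 <= itv_ends.2
}.

HB.instance Definition _ := [isSub for itv_ends].
HB.instance Definition _ := [Finite of intervals by <:].

Definition itv_set (s : intervals) : {set Q} :=
  [set x | (itv_ends s).1 <= x <= (itv_ends s).2].

Definition itv_le (s t : intervals) : bool := itv_set s \subset itv_set t.

Lemma itv_leE s t :
  itv_le s t = ((itv_ends t).1 <= (itv_ends s).1) && ((itv_ends s).2 <= (itv_ends t).2).
Proof.
rewrite /itv_le; apply/fintype.subsetP/andP => [st|[le1 le2] x]; last first.
  rewrite !inE => /andP[sx xs]; apply/andP; split.
    exact: le_trans sx.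
  exact: le_trans le2.
have s12 := valP s; split.
  by have := st (itv_ends s).1; rewrite !inE lexx s12 => /(_ isT)/andP[].
by have := st (itv_ends s).2; rewrite !inE lexx s12 => /(_ isT)/andP[].
Qed.

Lemma itv_le_refl : reflexive itv_le.
Proof. by move=> s; apply: subxx. Qed.

Lemma itv_le_anti : antisymmetric itv_le.
Proof.
move=> s t; rewrite !itv_leE => /andP[/andP[a b] /andP[c e]].
apply: val_inj => /=.
rewrite [itv_ends s]surjective_pairing [itv_ends t]surjective_pairing.
by congr pair; apply: le_anti; apply/andP; split.
Qed.

Lemma itv_le_trans : transitive itv_le.
Proof. by move=> t s u; apply: fintype.subset_trans. Qed.

HB.instance Definition _ :=
  Order.Le_isPOrder.Build d intervals itv_le_refl itv_le_anti itv_le_trans.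

End IntervalOrder.

(* h(Q) = (Q^#)^*; [T^d] is the library's opposite order. *)
Notation hposet Q := ((intervals Q)^d).

Definition r_ d (Q : finPOrderType d) (s : hposet Q) : Q :=
  (itv_ends s).1.

Definition rbar d (Q : finPOrderType d) (s : hposet Q) : Q^d :=
  (itv_ends s).2.

Section Pullback.
Context (dA dB dC : Order.disp_t).
Context (A : finPOrderType dA) (B : finPOrderType dB) (C : finPOrderType dC).
Context (f : A -> C) (g : B -> C).

Record pullback : Type := Pullback {
  pb_pair : A *p B;
  _ : f pb_pair.1 == g pb_pair.2
}.

HB.instance Definition _ := [isSub for pb_pair].
HB.instance Definition _ := [Finite of pullback by <:].
HB.instance Definition _ :=
  [SubChoice_isSubPOrder of pullback by <: with Order.prod_display dA dB].

Definition pb_fst (x : pullback) : A := (pb_pair x).1.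
Definition pb_snd (x : pullback) : B := (pb_pair x).2.

End Pullback.

Arguments pb_fst {dA dB dC A B C} f g x.
Arguments pb_snd {dA dB dC A B C} f g x.

(** * Subposets: subsets with the induced order *)

Section Subposets.
Context (d : Order.disp_t) (A : finPOrderType d).

Definition down (p : A) : {set A} := [set x | x <= p].
Definition ddown (p : A) : {set A} := [set x | x < p].

(* lk(p, E) for the subposet E of A *)
Definition lk (p : A) (E : {set A}) : {set A} := [set x in E | p < x].

Definition closed_in (D E : {set A}) : Prop :=
  D \subset E /\ (forall a x, a \in E -> x \in D -> a <= x -> a \in D).

(* The cone CD, as a subposet of the cone over the ambient poset A. *)
Definition cone_set (D : {set A}) : {set cone A} :=
  None |: [set (Some a : cone A) | a in D].

End Subposets.

(** * Cubical maps *)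

(* a is an isomorphism of the poset T onto the subposet S of A *)
Definition iso_onto d d' (T : finPOrderType d) (A : finPOrderType d')
    (a : T -> A) (S : {set A}) : Prop :=
  {mono a : x y / x <= y} /\ (forall y, y \in S <-> exists x, a x = y).

(* The isomorphisms alpha : CV x CW -> down a and beta : CV -> down (g a) carry
   the first projection to the restriction of g. *)
Definition cubical d d' (A : finPOrderType d) (B : finPOrderType d')
    (g : A -> B) : Prop :=
  monotone g /\
  forall a : A,
    exists (dV dW : Order.disp_t) (V : finPOrderType dV) (W : finPOrderType dW)
      (alpha : cone V *p cone W -> A) (beta : cone V -> B),
      [/\ iso_onto alpha (down a),
          iso_onto beta (down (g a))
        & forall x, g (alpha x) = beta x.1].

(** * Polyhedra and PL homeomorphisms *)

Section PL.
Local Open Scope ring_scope.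
Context (R : realType).

Definition polyhedral (I : finType) (K : set {ffun I -> R}) : Prop :=
  exists s : seq ({ffun I -> R} * R),
    K = [set x | forall h, h \in s -> \sum_i h.1 i * x i <= h.2]%classic.

(* The domain is a finite union of convex polyhedral sets on each of which F is
   affine; since these are closed, F is then continuous on X. *)
Definition piecewise_linear (I J : finType) (X : set {ffun I -> R})
    (F : {ffun I -> R} -> {ffun J -> R}) : Prop :=
  exists (n : nat) (K : 'I_n -> set {ffun I -> R}),
    (forall x, X x <-> exists i, K i x) /\
    forall i, polyhedral (K i) /\
      exists (M : J -> I -> R) (c : J -> R),
        forall x, K i x -> forall j, F x j = \sum_k M j k * x k + c j.

Definition PL_homeomorphism (I J : finType) (X : set {ffun I -> R})
    (Y : set {ffun J -> R}) (F : {ffun I -> R} -> {ffun J -> R}) : Prop :=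
  exists G : {ffun J -> R} -> {ffun I -> R},
    [/\ forall x, X x -> Y (F x) /\ G (F x) = x,
        forall y, Y y -> X (G y) /\ F (G y) = y,
        piecewise_linear X F
      & piecewise_linear Y G].

(* |S| for a subposet S of A, in barycentric coordinates indexed by A. *)
Definition realization d (A : finPOrderType d) (S : {set A}) :
    set {ffun A -> R} :=
  [set x | [/\ forall a, 0 <= x a,
               \sum_a x a = 1,
               forall a, x a != 0 -> a \in S
             & forall a b, x a != 0 -> x b != 0 -> (a >=< b)%O]]%classic.

(* The inclusion |D| -> |CD|. *)
Definition cone_incl (I : finType) (x : {ffun I -> R}) : {ffun cone I -> R} :=
  [ffun c => oapp x 0 c].

(* |E| is homeomorphic to |CD| keeping |D| fixed.  As |CD| is the simplicial
   cone over |D|, this serves both for subdivision maps and for collars. *)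
Definition homeo_to_cone d (A : finPOrderType d) (E D : {set A}) : Prop :=
  exists F : {ffun A -> R} -> {ffun cone A -> R},
    PL_homeomorphism (realization E) (realization (cone_set D)) F /\
    (forall x, realization D x -> F x = cone_incl x).

Definition subdivision_map d d' (A : finPOrderType d) (B : finPOrderType d')
    (g : A -> B) : Prop :=
  monotone g /\
  forall b : B, homeo_to_cone (g @^-1: down b) (g @^-1: ddown b).

Definition collared d (A : finPOrderType d) (D E : {set A}) : Prop :=
  closed_in D E /\ (forall x, x \in D -> homeo_to_cone (lk x E) (lk x D)).

Definition stratification_map d d' (A : finPOrderType d) (B : finPOrderType d')
    (g : A -> B) : Prop :=
  monotone g /\ (forall b : B, collared (g @^-1: ddown b) (g @^-1: down b)).

End PL.

(* Main.v *)
Require Import Defs.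
From HB Require Import structures.
From mathcomp Require Import all_boot all_order all_algebra.
From mathcomp Require Import classical_sets reals.
From mathcomp Require Import ring lra.

Set Implicit Arguments.
Unset Strict Implicit.
Unset Printing Implicit Defensive.

Import Order.TTheory GRing.Theory Num.Theory.
Local Open Scope ring_scope.

(** All four posets of the diagram are closed subposets of products: h(Q) of
    Q x Q^d, X of P x Q^d, Y of Q x R and Z of P x R, given by the condition that
    the first coordinate, mapped to Q, lies below the second one.  The down-set
    of an element of a closed subposet of A x C is the product of two down-sets,
    each of which is a cone, so the two projections are cubical
    (closed_embedding_cubical); these are r, rho_X and the other six maps.

    The maps g and h are restrictions of f x id, and psi and chi are restrictions
    of phi x id, to the preimage of a closed subposet.  So let f : A -> B, and
    let (b, c) be in the closed subposet of B x C.  With E and D the preimages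
    under f of the down-set and of the strict down-set of b, and T the down-set
    of c, the preimages under f x id are E x T and the union W0 of D x T and
    E x (T - c).

    If f is a subdivision map, a homeomorphism from |E| to |C D| gives one from
    |E x T| to |C D x T|, because the realization of a product of posets is the
    product of the realizations (prod_homeo).  The poset C D x T has a greatest
    element, so it is the cone over the union V0 of D x T and C D x (T - c), and
    the homeomorphism restricts to one from |W0| to |V0|.  Coning the inverse of
    this restriction leads from |C V0| to |C W0|, and the composite is the
    identity on |W0| (homeo_to_cone_prod).

    If f is a stratification map, the links of (a, e) in E x T and in W0 are
    needed.  If e = c they are the links of a in E and D, times a point.  If
    e < c and a is in D, the link is obtained from the product of two stars by
    removing the bottom element (a, e), and the argument above applies to the
    stars: coning the given homeomorphism of links from below preserves the
    barycentric coordinate at a, and the coordinate at the bottom of a product is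
    the minimum of the two coordinates, so that bottom elements can be left out
    (bottom_cone_homeo, link_face).  If e < c and a is not in D, the claim is that
    a product of two posets with bottom elements, the second with a top element c
    as well, is after removal of the bottom a cone over its part below c.  This
    holds for any such posets (homeo_to_cone_bottom), but needs a homeomorphism
    that is not given in advance.

    Both the product homeomorphism and the last one are written down by viewing a
    point of |A| as a monotone step function from [0, 1] to A that takes the
    value a on an interval whose length is the coordinate at a.  A point of
    |A x C| is then a pair of such functions: from its marginals it is recovered
    by intersecting intervals (coupling), which only uses sums, minima and maxima
    of the coordinates and hence is piecewise linear. *)

(** * Affine functions *)

Section PLFunctions.
Variable K : realType.
Implicit Types I J L : finType.

Definition affine_fun I (f : {ffun I -> K} -> K) :=
  exists (m : I -> K) (c : K), forall x, f x = \sum_k m k * x k + c.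

Lemma affine_cst I (c : K) : affine_fun (fun _ : {ffun I -> K} => c).
Proof.
exists (fun=> 0), c => x; rewrite big1 ?add0r // => i _; exact: mul0r.
Qed.

Lemma affine_coord I (i : I) : affine_fun (fun x : {ffun I -> K} => x i).
Proof.
exists (fun k => (k == i)%:R), 0 => x.
rewrite (bigD1 i) //= eqxx mul1r big1 ?addr0 // => j /negPf ->.
exact: mul0r.
Qed.

Lemma affine_add I (f g : {ffun I -> K} -> K) :
  affine_fun f -> affine_fun g -> affine_fun (fun x => f x + g x).
Proof.
move=> [m [c fE]] [n [e gE]]; exists (fun k => m k + n k), (c + e) => x.
rewrite fE gE addrACA -big_split /=; congr (_ + _).
by apply: eq_bigr => k _; rewrite mulrDl.
Qed.

Lemma affine_scale I (a : K) (f : {ffun I -> K} -> K) :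
  affine_fun f -> affine_fun (fun x => a * f x).
Proof.
move=> [m [c fE]]; exists (fun k => a * m k), (a * c) => x.
rewrite fE mulrDr mulr_sumr; congr (_ + _).
by apply: eq_bigr => k _; rewrite mulrA.
Qed.

Lemma affine_sum I (S : Type) (r : seq S) (p : pred S)
    (f : S -> {ffun I -> K} -> K) :
  (forall s, affine_fun (f s)) ->
  affine_fun (fun x => \sum_(s <- r | p s) f s x).
Proof.
move=> fA; elim: r => [|s r [m [c mE]]].
  by case: (affine_cst I 0) => m [c E]; exists m, c => x; rewrite big_nil; apply: E.
have [m' [c' E]] : affine_fun (fun x => (p s)%:R * f s x + \sum_(j <- r | p j) f j x).
  by apply: affine_add; [apply: affine_scale; apply: fA|exists m, c].
exists m', c' => x; rewrite big_cons -E.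
by case: (p s); rewrite ?mul1r ?mul0r ?add0r.
Qed.

(** * Finite unions of convex polyhedra *)

Lemma polyhedral_half I (f : {ffun I -> K} -> K) :
  affine_fun f -> polyhedral [set x | f x <= 0]%classic.
Proof.
move=> [m [c fE]]; exists [:: (finfun m, - c)].
apply/seteqP; split => x /=; rewrite fE.
  move=> le0 h; rewrite inE => /eqP -> /=.
  by under eq_bigr do rewrite ffunE; rewrite -subr_le0 opprK.
move=> /(_ _ (mem_head _ _)) /=.
by under eq_bigr do rewrite ffunE; rewrite -subr_le0 opprK.
Qed.

Lemma polyhedralT I : polyhedral (setT : set {ffun I -> K}).
Proof. by exists [::]; apply/seteqP; split => x //= _ h. Qed.

Lemma polyhedralI I (X Y : set {ffun I -> K}) :
  polyhedral X -> polyhedral Y -> polyhedral (X `&` Y)%classic.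
Proof.
move=> [s ->] [t ->]; exists (s ++ t); apply/seteqP; split => x /=.
  by move=> [xs xt] h; rewrite mem_cat => /orP[/xs|/xt].
by move=> xst; split => h hs; apply: xst; rewrite mem_cat hs ?orbT.
Qed.

Lemma polyhedral_all I (S : eqType) (r : seq S) (f : S -> {ffun I -> K} -> K) :
  (forall s, affine_fun (f s)) ->
  polyhedral [set x | forall s, s \in r -> f s x <= 0]%classic.
Proof.
move=> fA; elim: r => [|s r IH].
  by have -> : [set x | forall s : S, s \in [::] -> f s x <= 0]%classic = setT;
    [apply/seteqP|apply: polyhedralT].
have -> : ([set x | forall t, t \in s :: r -> f t x <= 0] =
  [set x | f s x <= 0%R] `&` [set x | forall t, t \in r -> f t x <= 0%R])%classic.
  apply/seteqP; split => x /=.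
    by move=> H; split=> [|t tr]; apply: H; rewrite inE ?eqxx ?tr ?orbT.
  by move=> [H1 H2] t; rewrite inE => /predU1P[->|/H2].
by apply: polyhedralI => //; apply: polyhedral_half.
Qed.

Lemma polyhedral_preimage I J (F : {ffun I -> K} -> {ffun J -> K})
    (Y : set {ffun J -> K}) :
  (forall j, affine_fun (fun x => F x j)) -> polyhedral Y ->
  polyhedral [set x | Y (F x)]%classic.
Proof.
move=> FA [s ->].
have -> : ([set x | [set x0 | forall h, h \in s -> \sum_i h.1 i * x0 i <= h.2] (F x)]
  = [set x | forall h, h \in s -> \sum_i h.1 i * F x i - h.2 <= 0%R])%classic.
  by apply/seteqP; split => x /= H h /H; rewrite subr_le0.
apply: polyhedral_all => h; apply: affine_add; last exact: affine_cst.
by apply: affine_sum => i; apply: affine_scale.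
Qed.

Definition is_cover I (X : set {ffun I -> K}) (T : finType)
    (P : T -> set {ffun I -> K}) :=
  (forall x, X x <-> exists t, P t x) /\ forall t, polyhedral (P t).

Definition polyhedron I (X : set {ffun I -> K}) :=
  exists (T : finType) (P : T -> set {ffun I -> K}), is_cover X P.

Definition affine_on I (P : set {ffun I -> K}) (f : {ffun I -> K} -> K) :=
  exists a, affine_fun a /\ forall x, P x -> f x = a x.

Lemma affine_on_sub I (P P' : set {ffun I -> K}) f :
  (forall x, P' x -> P x) -> affine_on P f -> affine_on P' f.
Proof. by move=> PP [a [aA aE]]; exists a; split=> // x /PP /aE. Qed.

(** A map on a polyhedron is piecewise linear exactly when its coordinates are;
    for scalar functions closure under sums, minima and maxima can be stated, so
    that explicit formulas need no bookkeeping of pieces. *)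
Definition pl_fun I (X : set {ffun I -> K}) (f : {ffun I -> K} -> K) :=
  exists (T : finType) (P : T -> set {ffun I -> K}),
    is_cover X P /\ forall t, affine_on (P t) f.

Lemma is_coverI I (X Y : set {ffun I -> K}) (T U : finType) P Q :
  @is_cover I X T P -> @is_cover I Y U Q ->
  @is_cover I (X `&` Y)%classic (T * U)%type (fun t => P t.1 `&` Q t.2)%classic.
Proof.
move=> [XP pP] [YQ pQ]; split=> [x|t]; last exact: polyhedralI.
split=> [[/XP[t xt] /YQ[u xu]]|[[t u] [/= xt xu]]]; first by exists (t, u).
by split; [apply/XP; exists t|apply/YQ; exists u].
Qed.

Lemma setI_id I (X : set {ffun I -> K}) : (X `&` X)%classic = X.
Proof. by apply/seteqP; split=> x //= []. Qed.

Lemma pl_fun_ext I (X : set {ffun I -> K}) f g :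
  (forall x, X x -> f x = g x) -> pl_fun X f -> pl_fun X g.
Proof.
move=> fg [T [P [cP aP]]]; exists T, P; split=> // t.
have [a [aA aE]] := aP t; exists a; split=> // x xt.
by rewrite -fg ?aE //; apply/(proj1 cP); exists t.
Qed.

Lemma pl_fun_common I (X : set {ffun I -> K}) f g :
  pl_fun X f -> pl_fun X g ->
  exists (T : finType) (P : T -> set {ffun I -> K}),
    is_cover X P /\ forall t, affine_on (P t) f /\ affine_on (P t) g.
Proof.
move=> [T [P [cP aP]]] [U [Q [cQ aQ]]].
exists (T * U)%type, (fun t => P t.1 `&` Q t.2)%classic; split.
  by rewrite -(setI_id X); apply: is_coverI.
by move=> [t u] /=; split; [apply: affine_on_sub (aP t) => x []|
  apply: affine_on_sub (aQ u) => x []].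
Qed.

Lemma pl_fun_affine I (X : set {ffun I -> K}) f :
  polyhedron X -> affine_fun f -> pl_fun X f.
Proof. by move=> [T [P cP]] fA; exists T, P; split=> // t; exists f. Qed.

Lemma pl_fun_cst I (X : set {ffun I -> K}) c : polyhedron X -> pl_fun X (fun=> c).
Proof. by move=> pX; apply: pl_fun_affine => //; apply: affine_cst. Qed.

Lemma pl_fun_coord I (X : set {ffun I -> K}) i : polyhedron X -> pl_fun X (fun x => x i).
Proof. by move=> pX; apply: pl_fun_affine => //; apply: affine_coord. Qed.

Lemma pl_fun_add I (X : set {ffun I -> K}) f g :
  pl_fun X f -> pl_fun X g -> pl_fun X (fun x => f x + g x).
Proof.
move=> fP gP; have [T [P [cP aP]]] := pl_fun_common fP gP.
exists T, P; split=> // t; have [[a [aA aE]] [b [bA bE]]] := aP t.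
by exists (fun x => a x + b x); split=> [|x xt]; [apply: affine_add|rewrite aE ?bE].
Qed.

Lemma pl_fun_scale I (X : set {ffun I -> K}) c f :
  pl_fun X f -> pl_fun X (fun x => c * f x).
Proof.
move=> [T [P [cP aP]]]; exists T, P; split=> // t; have [a [aA aE]] := aP t.
by exists (fun x => c * a x); split=> [|x xt]; [apply: affine_scale|rewrite aE].
Qed.

Lemma pl_fun_opp I (X : set {ffun I -> K}) f : pl_fun X f -> pl_fun X (fun x => - f x).
Proof.
by move=> /(pl_fun_scale (-1)); apply: pl_fun_ext => x _; rewrite mulN1r.
Qed.

Lemma pl_fun_sum I (X : set {ffun I -> K}) (S : Type) (r : seq S) (p : pred S)
    (f : S -> {ffun I -> K} -> K) :
  polyhedron X -> (forall s, p s -> pl_fun X (f s)) ->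
  pl_fun X (fun x => \sum_(s <- r | p s) f s x).
Proof.
move=> pX fP; elim: r => [|s r IH].
  by apply: pl_fun_ext (pl_fun_cst 0 pX) => x _; rewrite big_nil.
have [ps|nps] := boolP (p s).
  apply: pl_fun_ext (pl_fun_add (fP s ps) IH) => x _.
  by rewrite big_cons ps.
by apply: pl_fun_ext IH => x _; rewrite big_cons (negPf nps).
Qed.

(** Each piece is cut in two by the sign of f - g, which is affine there. *)
Lemma pl_fun_max I (X : set {ffun I -> K}) f g :
  pl_fun X f -> pl_fun X g -> pl_fun X (fun x => Num.max (f x) (g x)).
Proof.
move=> fP gP; have [T [P [[XP pP] aP]]] := pl_fun_common fP gP.
have [a aE] := fin_all_exists (fun t => proj1 (aP t)).
have [b bE] := fin_all_exists (fun t => proj2 (aP t)).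
pose s (e : bool) : K := (-1) ^+ e.
exists (T * bool)%type,
  (fun t => P t.1 `&` [set x | (s t.2) * (a t.1 x - b t.1 x) <= 0%R])%classic.
split; first split.
- move=> x; split=> [/XP[t xt]|[[t e] [/= xt _]]]; last by apply/XP; exists t.
  have [le|le] := lerP (a t x) (b t x).
    by exists (t, false); split=> //=; rewrite /s /= mul1r subr_le0.
  by exists (t, true); split=> //=; rewrite /s /= expr1 mulN1r opprB subr_le0 ltW.
- move=> t; apply: polyhedralI => //; apply: polyhedral_half.
  have [[aA _] [bA _]] := (aE t.1, bE t.1).
  apply: affine_scale; apply: affine_add => //.
  have [m [c mE]] := affine_scale (-1) bA.
  by exists m, c => x; rewrite -mE mulN1r.
- move=> [t e] /=; have [[aA fa] [bA gb]] := (aE t, bE t).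
  exists (if e then a t else b t); split; first by case: e.
  move=> x [xt]; rewrite /s fa // gb //; case: e => /=.
    by rewrite expr1 mulN1r opprB subr_le0 => /max_idPl.
  by rewrite mul1r subr_le0 => /max_idPr.
Qed.

Lemma pl_fun_min I (X : set {ffun I -> K}) f g :
  pl_fun X f -> pl_fun X g -> pl_fun X (fun x => Num.min (f x) (g x)).
Proof.
move=> /pl_fun_opp fP /pl_fun_opp gP.
apply: pl_fun_ext (pl_fun_opp (pl_fun_max fP gP)) => x _.
by rewrite oppr_max !opprK.
Qed.

Lemma pl_fun_sub I (X Y : set {ffun I -> K}) f :
  polyhedron Y -> (forall x, Y x -> X x) -> pl_fun X f -> pl_fun Y f.
Proof.
move=> [U [Q cQ]] YX [T [P [cP aP]]].
exists (T * U)%type, (fun t => P t.1 `&` Q t.2)%classic; split.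
  have -> : Y = (X `&` Y)%classic by apply/seteqP; split=> x //= => [/[dup]/YX|[]].
  exact: is_coverI.
by move=> t; apply: affine_on_sub (aP t.1) => x [].
Qed.

(** * Piecewise linear maps *)

Lemma piecewise_linear_polyhedron I J (X : set {ffun I -> K}) (F : _ -> {ffun J -> K}) :
  piecewise_linear X F -> polyhedron X.
Proof.
by move=> [n [P [XP PP]]]; exists 'I_n, P; split=> // i; case: (PP i).
Qed.

Lemma piecewise_linear_coord I J (X : set {ffun I -> K}) (F : _ -> {ffun J -> K}) j :
  piecewise_linear X F -> pl_fun X (fun x => F x j).
Proof.
move=> [n [P [XP PP]]]; exists 'I_n, P; split; first by split=> // i; case: (PP i).
move=> i; have [_ [M [c E]]] := PP i.
by exists (fun x => \sum_k M j k * x k + c j); split=> [|x /E]; first by exists (M j), (c j).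
Qed.

Lemma piecewise_linear_pieces I J (X : set {ffun I -> K}) (F : _ -> {ffun J -> K}) :
  polyhedron X -> (forall j, pl_fun X (fun x => F x j)) ->
  exists (T : finType) (P : T -> set {ffun I -> K}),
    is_cover X P /\ forall t j, affine_on (P t) (fun x => F x j).
Proof.
move=> [U [Q cQ]] FP.
have [T [P [cP aP]]] : exists (T : finType) (P : T -> set {ffun I -> K}),
    is_cover X P /\ forall t j, j \in enum J -> affine_on (P t) (fun x => F x j).
  elim: (enum J) => [|j r [T [P [cP aP]]]]; first by exists U, Q.
  have [T' [P' [cP' aP']]] := FP j.
  exists (T * T')%type, (fun t => P t.1 `&` P' t.2)%classic; split.
    by rewrite -(setI_id X); apply: is_coverI.
  move=> [t t'] i; rewrite inE => /predU1P[->|ir].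
    by apply: affine_on_sub (aP' t') => x [].
  by apply: affine_on_sub (aP t _ ir) => x [].
by exists T, P; split=> // t j; apply: aP; rewrite mem_enum.
Qed.

Lemma piecewise_linear_intro I J (X : set {ffun I -> K}) (F : _ -> {ffun J -> K}) :
  polyhedron X -> (forall j, pl_fun X (fun x => F x j)) -> piecewise_linear X F.
Proof.
move=> pX /(piecewise_linear_pieces pX) [T [P [[XP pP] aP]]].
exists #|T|, (P \o enum_val); split.
  move=> x; rewrite XP; split=> [[t xt]|[i xi]]; last by exists (enum_val i).
  by exists (enum_rank t); rewrite /= enum_rankK.
move=> i; split; first exact: pP.
have [a aE] := fin_all_exists (aP (enum_val i)).
have [M ME] := fin_all_exists (fun j => proj1 (aE j)).
have [c cE] := fin_all_exists ME.
by exists M, c => x xi j; rewrite (proj2 (aE j)) // cE.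
Qed.

(** The pieces are those of F, cut by the preimages of the pieces of g. *)
Lemma pl_fun_comp I J (X : set {ffun I -> K}) (Y : set {ffun J -> K}) F g :
  piecewise_linear X F -> (forall x, X x -> Y (F x)) -> pl_fun Y g ->
  pl_fun X (fun x => g (F x)).
Proof.
move=> FP FY [U [Q [[YQ pQ] aQ]]].
have pX := piecewise_linear_polyhedron FP.
have [T [P [[XP pP] aP]]] :=
  piecewise_linear_pieces pX (fun j => piecewise_linear_coord j FP).
have [a aE] := fin_all_exists (fun t => fin_all_exists (aP t)).
pose A t x := [ffun j => a t j x].
have AA t j : affine_fun (fun x => A t x j).
  have [[m [c E]] _] := aE t j; exists m, c => x; by rewrite ffunE E.
have AE t x : P t x -> F x = A t x.
  by move=> xt; apply/ffunP => j; rewrite ffunE; apply: (proj2 (aE t j)).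
exists (T * U)%type, (fun t => P t.1 `&` [set x | Q t.2 (A t.1 x)])%classic.
split; first split.
- move=> x; split=> [Xx|[[t u] [/= xt _]]]; last by apply/XP; exists t.
  have [t xt] := proj1 (XP x) Xx; have [u xu] := proj1 (YQ _) (FY _ Xx).
  by exists (t, u); split=> //=; rewrite -AE.
- by move=> t; apply: polyhedralI => //; apply: polyhedral_preimage.
- move=> [t u] /=; have [b [bA bE]] := aQ u; exists (b \o A t); split.
    have [m [c mE]] := bA.
    have [m' [c' E]] : affine_fun (fun x => \sum_k m k * A t x k + c).
      apply: affine_add; last exact: affine_cst.
      by apply: affine_sum => k; apply: affine_scale.
    by exists m', c' => x; rewrite -E /= mE.
  by move=> x [xt xu] /=; rewrite (AE t x xt) bE.
Qed.

Lemma piecewise_linear_comp I J L (X : set {ffun I -> K}) (Y : set {ffun J -> K})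
    F (G : _ -> {ffun L -> K}) :
  piecewise_linear X F -> (forall x, X x -> Y (F x)) -> piecewise_linear Y G ->
  piecewise_linear X (G \o F).
Proof.
move=> FP FY GP; apply: piecewise_linear_intro.
  exact: piecewise_linear_polyhedron FP.
move=> j; exact: (pl_fun_comp FP FY (piecewise_linear_coord j GP)).
Qed.

(** The inverse is an explicit argument because restrictions, cones and products
    are taken of both directions. *)
Definition pl_homeo I J (X : set {ffun I -> K}) (Y : set {ffun J -> K}) F G :=
  [/\ forall x, X x -> Y (F x) /\ G (F x) = x,
      forall y, Y y -> X (G y) /\ F (G y) = y,
      piecewise_linear X F & piecewise_linear Y G].

Lemma pl_homeo_sym I J (X : set {ffun I -> K}) (Y : set {ffun J -> K}) F G :
  pl_homeo X Y F G -> pl_homeo Y X G F.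
Proof. by case. Qed.

Lemma pl_homeo_comp I J L (X : set {ffun I -> K}) (Y : set {ffun J -> K})
    (Z : set {ffun L -> K}) F G F' G' :
  pl_homeo X Y F G -> pl_homeo Y Z F' G' -> pl_homeo X Z (F' \o F) (G \o G').
Proof.
move=> [h1 h2 h3 h4] [k1 k2 k3 k4]; split.
- move=> x /h1[Yx E]; have [Zx E'] := k1 _ Yx; split=> //=.
  by rewrite E' E.
- move=> x /k2[Yx E]; have [Zx E'] := h2 _ Yx; split=> //=.
  by rewrite E' E.
- by apply: piecewise_linear_comp h3 _ k3 => x /h1[].
- by apply: piecewise_linear_comp k4 _ h4 => x /k2[].
Qed.

Lemma pl_homeo_restrict I J (X X' : set {ffun I -> K}) (Y Y' : set {ffun J -> K}) F G :
  pl_homeo X Y F G -> polyhedron X' -> polyhedron Y' ->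
  (forall x, X' x -> X x /\ Y' (F x)) -> (forall y, Y' y -> Y y /\ X' (G y)) ->
  pl_homeo X' Y' F G.
Proof.
move=> [h1 h2 h3 h4] pX pY hX hY; split.
- by move=> x /hX[/h1[_ E] Yx].
- by move=> x /hY[/h2[_ E] Yx].
- apply: piecewise_linear_intro => // j.
  by apply: pl_fun_sub (piecewise_linear_coord j h3) => // x /hX[].
- apply: piecewise_linear_intro => // j.
  by apply: pl_fun_sub (piecewise_linear_coord j h4) => // x /hY[].
Qed.

End PLFunctions.

(** * Realizations *)

Lemma sum_neq0 (V : nmodType) (I : finType) (p : pred I) (F : I -> V) :
  \sum_(i | p i) F i != 0 -> exists2 i, p i & F i != 0.
Proof.
move=> n0; have [/existsP[i /andP[]]|] := boolP [exists i, p i && (F i != 0)].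
  by exists i.
rewrite negb_exists => /forallP H; case/eqP: n0; apply: big1 => i pi.
by have := H i; rewrite pi /= negbK => /eqP.
Qed.

Lemma sum_supp (V : nmodType) (I : finType) (p : pred I) (F : I -> V) :
  (forall i, F i != 0 -> p i) -> \sum_i F i = \sum_(i | p i) F i.
Proof.
move=> Fp; rewrite [RHS]big_mkcond; apply: eq_bigr => i _.
by case: ifP => // /negbT; apply: contraNeq => /Fp.
Qed.

Lemma sum_cone (V : nmodType) (T : finType) (F : cone T -> V) (p : pred (cone T)) :
  \sum_(c | p c) F c = (if p None then F None else 0) + \sum_(a | p (Some a)) F (Some a).
Proof.
rewrite big_mkcond (bigD1 (None : cone T)) //=; congr (_ + _).
rewrite -big_mkcondr /= (reindex_omap (Some : T -> cone T) id) /=.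
  by apply: eq_bigl => a; rewrite eqxx andbT.
by case.
Qed.

Section Realization.
Variable K : realType.
Local Notation geom S := (@realization K _ _ S%SET).

Section Basics.
Context (d : Order.disp_t) (A : finPOrderType d).
Implicit Types (S E : {set A}) (x : {ffun A -> K}).

(** The pieces are the simplices, one for each chain t in S; a set t that is not
    a chain in S gets an empty piece through the constant constraint. *)
Lemma polyhedron_realization S : polyhedron (geom S).
Proof.
pose good (t : {set A}) := (t \subset S) && [forall a in t, forall b in t, (a >=< b)%O].
pose c (t : {set A}) (e : option ((A + A) + bool)) (x : {ffun A -> K}) :=
  match e with
  | None => (~~ good t)%:R
  | Some (inl (inl a)) => - 1 * x a
  | Some (inl (inr a)) => (a \notin t)%:R * x a
  | Some (inr b) => (-1) ^+ b * (\sum_a x a + (- 1))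
  end.
exists {set A}, (fun t => [set x | forall e, e \in enum {: option ((A + A) + bool)} ->
  c t e x <= 0]%classic); split; last first.
  move=> t; apply: polyhedral_all => -[[[a|a]|b]|] /=.
  - exact/affine_scale/affine_coord.
  - exact/affine_scale/affine_coord.
  - apply/affine_scale/affine_add/affine_cst.
    by apply: affine_sum => a; apply: affine_coord.
  - exact: affine_cst.
move=> x; split.
  move=> [x0 x1 xS xc]; exists [set a | x a != 0] => e _.
  case: e => [[[a|a]|b]|] /=.
  - by rewrite mulN1r oppr_le0.
  - by rewrite inE negbK; case: eqP => [->|]; rewrite ?mulr0 ?mul0r.
  - by rewrite x1 subrr mulr0.
  - suff -> : good [set a | x a != 0] by [].
    apply/andP; split; first by apply/fintype.subsetP => a; rewrite inE => /xS.
    by apply/forall_inP => a; rewrite inE => xa; apply/forall_inP => b; rewrite inE => /(xc _ _ xa).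
move=> [t H].
have {}H e : c t e x <= 0 by apply: H; rewrite mem_enum.
have x0 a : 0 <= x a by have := H (Some (inl (inl a))); rewrite /= mulN1r oppr_le0.
have gt : good t.
  have := H None; rewrite /=; case: (good t) => //=.
  by rewrite ler10.
have xt a : x a != 0 -> a \in t.
  apply: contraNT => at_; have := H (Some (inl (inr a))).
  by rewrite /= at_ mul1r => xa; rewrite eq_le x0 xa.
have [tS tc] := andP gt; split=> //.
- apply: le_anti; have := H (Some (inr false)); have := H (Some (inr true)).
  rewrite /= expr0 expr1 mulN1r mul1r oppr_le0 subr_ge0 subr_le0 => -> ->.
  by [].
- by move=> a /xt; apply: (fintype.subsetP tS).
- by move=> a b /xt /(forall_inP tc) /forall_inP tb /xt /tb.
Qed.

Lemma realization_sub S E x : S \subset E -> geom S x -> geom E x.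
Proof.
by move=> /fintype.subsetP SE [x0 x1 xS xc]; split=> // a /xS /SE.
Qed.

Lemma realization_intro S E x :
  geom E x -> (forall a, x a != 0 -> a \in S) -> geom S x.
Proof. by move=> [x0 x1 _ xc] xS; split. Qed.

Lemma realization_out S x a : geom S x -> a \notin S -> x a = 0.
Proof. by move=> [_ _ xS _]; apply: contraNeq => /xS. Qed.

End Basics.

Section Iso.
Context (d d' : Order.disp_t) (A : finPOrderType d) (B : finPOrderType d').
Variables (E : {set A}) (i : A -> B).

Definition push (x : {ffun A -> K}) : {ffun B -> K} :=
  [ffun b => \sum_(a in E | i a == b) x a].
Definition pull (y : {ffun B -> K}) : {ffun A -> K} :=
  [ffun a => (a \in E)%:R * y (i a)].

Hypothesis i_inj : {in E &, injective i}.

Lemma pushE x a : a \in E -> push x (i a) = x a.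
Proof.
move=> aE; rewrite ffunE (bigD1 a) ?aE ?eqxx //= big1 ?addr0 // => b.
by move=> /andP[/andP[bE /eqP /i_inj ->]] //; rewrite eqxx.
Qed.

Lemma push_out x b : b \notin i @: E -> push x b = 0.
Proof.
move=> bE; rewrite ffunE big1 // => a /andP[aE /eqP ab].
by case/negP: bE; rewrite -ab imset_f.
Qed.

Lemma push_neq0 x b : push x b != 0 -> exists a, [/\ a \in E, i a = b & x a != 0].
Proof. by rewrite ffunE => /sum_neq0[a /andP[aE /eqP ab] xa]; exists a. Qed.

Lemma affine_push b : affine_fun (fun x => push x b).
Proof.
have [m [c mE]] : affine_fun (fun x : {ffun A -> K} => \sum_(a in E | i a == b) x a).
  by apply: affine_sum => a; apply: affine_coord.
by exists m, c => x; rewrite ffunE mE.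
Qed.

Lemma affine_pull a : affine_fun (fun y => pull y a).
Proof.
have [m [c mE]] := affine_scale (a \in E)%:R (affine_coord K (i a)).
by exists m, c => x; rewrite ffunE mE.
Qed.

Hypothesis i_comp : {in E &, forall a b, (i a >=< i b)%O = (a >=< b)%O}.

(** Only comparability matters for the realization, so the map i need not be
    monotone: a bottom element may be turned into a top one. *)
Lemma realization_iso : pl_homeo (geom E) (geom (i @: E)) push pull.
Proof.
split.
- move=> x [x0 x1 xE xc]; split.
    split.
    + by move=> b; rewrite ffunE; apply: sumr_ge0.
    + rewrite (sum_supp (p := fun b => b \in i @: E)); last first.
        by move=> b; apply: contraNT => /push_out ->.
      rewrite big_imset //= -x1 [RHS](sum_supp (p := fun a => a \in E)) //.
      by apply: eq_bigr => a aE; rewrite pushE.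
    + by move=> b /push_neq0[a [aE <- _]]; apply: imset_f.
    + move=> b c /push_neq0[a [aE <- xa]] /push_neq0[a' [aE' <- xa']].
      by rewrite i_comp // xc.
  apply/ffunP => a; rewrite ffunE; have [aE|aE] := boolP (a \in E).
    by rewrite mul1r pushE.
  by rewrite mul0r; apply/esym/eqP; apply: contraNT aE => /xE.
- move=> y [y0 y1 yE yc].
  have pullE a : a \in E -> pull y a = y (i a) by move=> aE; rewrite ffunE aE mul1r.
  have pullN a : pull y a != 0 -> a \in E /\ y (i a) != 0.
    by rewrite ffunE; case: (a \in E); rewrite ?mul1r ?mul0r ?eqxx.
  split.
    split.
    + by move=> a; rewrite ffunE mulr_ge0 // ler0n.
    + rewrite (sum_supp (p := fun a => a \in E)); last by move=> a /pullN[].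
      rewrite -y1 (sum_supp (p := fun b => b \in i @: E)) //.
      by rewrite big_imset //=; apply: eq_bigr => a /pullE.
    + by move=> a /pullN[].
    + by move=> a b /pullN[aE ya] /pullN[bE yb]; rewrite -i_comp // yc.
  apply/ffunP => b; have [/imsetP[a aE ->]|bE] := boolP (b \in i @: E).
    by rewrite pushE // pullE.
  by rewrite push_out //; apply/esym/eqP; apply: contraNT bE => /yE.
- apply: piecewise_linear_intro; first exact: polyhedron_realization.
  move=> b; apply: pl_fun_affine; first exact: polyhedron_realization.
  exact: affine_push.
- apply: piecewise_linear_intro; first exact: polyhedron_realization.
  move=> b; apply: pl_fun_affine; first exact: polyhedron_realization.
  exact: affine_pull.
Qed.

End Iso.

(** * Cones *)

Section ConeBasics.
Context (d : Order.disp_t) (A : finPOrderType d).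
Implicit Types (S : {set A}) (z : {ffun cone A -> K}).

Lemma cone_set_None S : (None : cone A) \in cone_set S.
Proof. by rewrite inE set11. Qed.

Lemma cone_set_Some S a : ((Some a : cone A) \in cone_set S) = (a \in S).
Proof.
rewrite !inE /=; apply/imsetP/idP => [[b bS [->]] //|aS].
by exists a.
Qed.

Lemma cone_comparable (x y : cone A) :
  (x >=< y)%O = if x is Some a then if y is Some b then (a >=< b)%O else true else true.
Proof. by case: x => [a|]; case: y => [b|]. Qed.

Lemma cone_apex_le1 z : (forall c, 0 <= z c) -> \sum_c z c = 1 -> z None <= 1.
Proof. by move=> z0 <-; rewrite (sum_cone _ xpredT) /= lerDl sumr_ge0. Qed.

Lemma cone_apex_eq1 z a : (forall c, 0 <= z c) -> \sum_c z c = 1 ->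
  z None = 1 -> z (Some a) = 0.
Proof.
move=> z0 + zN; rewrite (sum_cone _ xpredT) /= zN => /eqP.
rewrite -subr_eq0 [1 + _]addrC addrK psumr_eq0 // => /allP /(_ a).
by rewrite mem_index_enum => /(_ isT) /eqP.
Qed.

(** The projection of a cone from its apex to its base.  At the apex itself the
    denominator vanishes and the result is 0, outside the base. *)
Definition cone_base z : {ffun A -> K} := [ffun a => z (Some a) / (1 - z None)].

Lemma realization_cone_base S z :
  geom (cone_set S) z -> z None != 1 -> geom S (cone_base z).
Proof.
move=> [z0 z1 zS zc] n1.
have zN : z None <= 1 by apply: cone_apex_le1.
have gt0 : 0 < 1 - z None by rewrite subr_gt0 lt_neqAle n1.
split.
- by move=> a; rewrite ffunE divr_ge0 // ltW.
- under eq_bigr do rewrite ffunE.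
  rewrite -mulr_suml -[X in _ / (X - _)]z1 (sum_cone _ xpredT) /=.
  rewrite [z None + _]addrC addrK divff //.
  have /eqP := z1; rewrite (sum_cone _ xpredT) /= addrC eq_sym -subr_eq => /eqP <-.
  by rewrite gt_eqF.
- move=> a; rewrite ffunE => /eqP H; rewrite -cone_set_Some; apply: zS.
  by apply/eqP => H'; apply: H; rewrite H' mul0r.
- move=> a b; rewrite !ffunE !mulf_eq0 !negb_or => /andP[za _] /andP[zb _].
  exact: zc za zb.
Qed.

Lemma realization_cone_le1 S z : geom (cone_set S) z -> z None <= 1.
Proof. by move=> [z0 z1 _ _]; apply: cone_apex_le1. Qed.

Lemma realization_cone_apex S z a :
  geom (cone_set S) z -> z None = 1 -> z (Some a) = 0.
Proof. by move=> [z0 z1 _ _]; apply: cone_apex_eq1. Qed.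

Lemma realization_cone_intro S z (y : {ffun A -> K}) :
  0 <= z None <= 1 -> (forall a, z (Some a) = (1 - z None) * y a) ->
  (z None != 1 -> geom S y) -> geom (cone_set S) z.
Proof.
move=> /andP[zN0 zN1] zE Sy.
have yS a : z (Some a) != 0 -> geom S y /\ y a != 0.
  rewrite zE mulf_eq0 negb_or subr_eq0 eq_sym => /andP[/Sy Sy' ->].
  by [].
split.
- case=> // a; have [//|/yS[[y0 _ _ _] _]] := eqVneq (z (Some a)) 0; first by move->.
  by rewrite zE mulr_ge0 // subr_ge0.
- rewrite (sum_cone _ xpredT) /=; under eq_bigr do rewrite zE.
  rewrite -mulr_sumr; have [->|/Sy[_ -> _ _]] := eqVneq (z None) 1.
    by rewrite subrr mul0r addr0.
  by rewrite mulr1 addrC subrK.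
- case=> [a /yS[[_ _ yS' _] ya]|_]; last exact: cone_set_None.
  by rewrite cone_set_Some yS'.
- move=> [a|] [b|] za zb; rewrite cone_comparable //.
  by have [[_ _ _ yc] ya] := yS _ za; have [_ yb] := yS _ zb; apply: yc.
Qed.

(** The pieces of the cone are the cones over the pieces; on each of them the
    homogenization of an affine function is linear.  The apex is a piece of its
    own since the base may be empty. *)
Lemma pl_fun_cone S f :
  pl_fun (geom S) f ->
  pl_fun (geom (cone_set S)) (fun z => (1 - z None) * f (cone_base z)).
Proof.
move=> [T [P [[SP pP] aP]]].
have [s sE] := fin_all_exists pP.
have stdE z : (forall c, 0 <= z c) -> \sum_c z c = 1 ->
    z None = 1 \/ 0 < 1 - z None.
  move=> z0 z1; have := cone_apex_le1 z0 z1.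
  by rewrite le_eqVlt subr_gt0 => /predU1P; case; [left|right].
pose std := [set z : {ffun cone A -> K} | forall e, e \in enum {: cone A + bool} ->
  (match e with inl c => -1 * z c | inr b => (-1) ^+ b * (\sum_c z c + (- 1)) end) <= 0]%classic.
have pstd : polyhedral std.
  apply: polyhedral_all => -[c|b]; first exact/affine_scale/affine_coord.
  apply/affine_scale/affine_add/affine_cst.
  by apply: affine_sum => a; apply: affine_coord.
have stdP z : std z <-> (forall c, 0 <= z c) /\ \sum_c z c = 1.
  split=> [H|[z0 z1] [c|b] _]; last first.
  - by rewrite z1 subrr mulr0.
  - by rewrite mulN1r oppr_le0.
  have {}H e := H e (mem_enum predT e).
  split=> [c|]; first by have := H (inl c); rewrite mulN1r oppr_le0.
  apply: le_anti; have := H (inr false); have := H (inr true).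
  by rewrite /= expr0 expr1 mulN1r mul1r oppr_le0 subr_ge0 subr_le0 => -> ->.
(* A point of std on the affine hyperplane z None = 1 is the apex. *)
pose Q (t : option T) : set {ffun cone A -> K} := if t is Some t then
  (std `&` [set z | forall h, h \in s t ->
     (\sum_a h.1 a * z (Some a) + - h.2 * (1 + - 1 * z None)) <= 0%R])%classic
  else (std `&` [set z | 1 + -1 * z None <= 0%R])%classic.
have QP z t : z None != 1 -> std z -> Q (Some t) z <-> P t (cone_base z).
  move=> n1 /[dup] sz /stdP[z0 z1]; have [e|gt0] := stdE _ z0 z1.
    by rewrite e eqxx in n1.
  have H (h : {ffun A -> K} * K) : (\sum_a h.1 a * z (Some a) + - h.2 * (1 + - 1 * z None) <= 0)
      = (\sum_a h.1 a * cone_base z a <= h.2).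
    rewrite mulN1r mulNr subr_le0 -ler_pdivrMr // mulr_suml.
    by congr (_ <= _); apply: eq_bigr => a _; rewrite ffunE mulrA.
  rewrite sE /=; split=> [[_ Hz] h hs|Hz]; first by rewrite -H Hz.
  by split=> // h hs; rewrite H Hz.
exists (option T), Q; split; first split.
- move=> z; split=> [Cz|[t Qz]].
    have sz : std z by apply/stdP; case: Cz.
    have [e|n1] := eqVneq (z None) 1.
      by exists None; split=> //=; rewrite e mulN1r subrr.
    have [t Pt] := proj1 (SP _) (realization_cone_base Cz n1).
    by exists (Some t); apply/QP.
  have sz : std z by case: t Qz => [t|] [].
  have /stdP[z0 z1] := sz.
  apply: (@realization_cone_intro _ _ (cone_base z)).
  + by rewrite z0 cone_apex_le1.
  + move=> a; rewrite ffunE; have [e|gt0] := stdE _ z0 z1.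
      by rewrite e subrr mul0r cone_apex_eq1.
    by rewrite mulrC divfK // gt_eqF.
  + move=> n1; apply/SP; case: t Qz => [t|[_ /=]]; first by exists t; apply/QP.
    have [e|gt0] := stdE _ z0 z1; first by rewrite e eqxx in n1.
    by rewrite mulN1r leNgt gt0.
- case=> [t|]; apply: polyhedralI => //.
    apply: polyhedral_all => h; apply: affine_add.
      by apply: affine_sum => a; apply/affine_scale/affine_coord.
    apply/affine_scale/affine_add; first exact: affine_cst.
    exact/affine_scale/affine_coord.
  apply: polyhedral_half; apply: affine_add; first exact: affine_cst.
  exact/affine_scale/affine_coord.
- case=> [t|]; last first.
    exists (fun=> 0); split=> [|z [/stdP[z0 z1] /= le]]; first exact: affine_cst.
    have [->|] := stdE _ z0 z1; first by rewrite subrr mul0r.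
    by rewrite ltNge -mulN1r le.
  have [a [[m [c mE]] aE]] := aP t.
  exists (fun z => \sum_a m a * z (Some a) + c * (1 + -1 * z None)); split.
    apply: affine_add; first by apply: affine_sum => b; apply/affine_scale/affine_coord.
    apply/affine_scale/affine_add; first exact: affine_cst.
    exact/affine_scale/affine_coord.
  move=> z Qz; have sz : std z by case: Qz.
  have /stdP[z0 z1] := sz; have [e|gt0] := stdE _ z0 z1.
    rewrite e mulN1r subrr mul0r mulr0 addr0 big1 // => b _.
    by rewrite cone_apex_eq1 ?mulr0.
  have n1 : z None != 1 by rewrite lt_eqF // -subr_gt0.
  rewrite aE; last by apply/QP.
  rewrite mE mulN1r mulrDr mulr_sumr [_ * c]mulrC; congr (_ + _).
  by apply: eq_bigr => b _; rewrite ffunE mulrCA mulrA [_ * z _]mulrC; field; rewrite gt_eqF.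
Qed.

End ConeBasics.

Section ConeMap.
Context (d d' : Order.disp_t) (A : finPOrderType d) (B : finPOrderType d').

(** The cone over F.  At the apex the factor 1 - z None is 0, so the value of F
    outside the base does not matter. *)
Definition cone_map (F : {ffun A -> K} -> {ffun B -> K}) (z : {ffun cone A -> K}) :
    {ffun cone B -> K} :=
  [ffun c : cone B => if c is Some b then (1 - z None) * F (cone_base z) b else z None].

Lemma cone_map_incl F x : cone_map F (cone_incl x) = cone_incl (F x).
Proof.
apply/ffunP => -[b|]; rewrite !ffunE //= subr0 mul1r; congr (F _ b).
by apply/ffunP => a; rewrite !ffunE /= subr0 divr1.
Qed.

Lemma cone_map_base F (z : {ffun cone A -> K}) : z None != 1 -> cone_base (cone_map F z) = F (cone_base z).
Proof.
move=> n1; apply/ffunP => b; rewrite !ffunE mulrC mulrA mulVf ?mul1r //.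
by rewrite subr_eq0 eq_sym.
Qed.

End ConeMap.

Section ConeHomeo.
Context (d d' : Order.disp_t) (A : finPOrderType d) (B : finPOrderType d').

Lemma cone_map_into (S : {set A}) (S' : {set B}) (F : {ffun A -> K} -> {ffun B -> K}) z :
  (forall x, geom S x -> geom S' (F x)) ->
  geom (cone_set S) z -> geom (cone_set S') (cone_map F z).
Proof.
move=> FS Cz; apply: (@realization_cone_intro _ _ _ _ (F (cone_base z))).
- by rewrite ffunE (realization_cone_le1 Cz) andbT; case: Cz.
- by move=> a; rewrite !ffunE.
- by rewrite ffunE => n1; apply/FS/realization_cone_base.
Qed.

Lemma cone_mapK (S : {set A}) (S' : {set B}) (F : {ffun A -> K} -> {ffun B -> K}) G z :
  (forall x, geom S x -> G (F x) = x) ->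
  geom (cone_set S) z -> cone_map G (cone_map F z) = z.
Proof.
move=> FK Cz; apply/ffunP => -[a|]; rewrite ffunE; last by rewrite ffunE.
have [e|n1] := eqVneq (z None) 1.
  by rewrite !ffunE e subrr mul0r (realization_cone_apex a Cz e).
rewrite cone_map_base // FK; last exact: realization_cone_base.
by rewrite !ffunE mulrC divfK // subr_eq0 eq_sym.
Qed.

Lemma piecewise_linear_cone (S : {set A}) (F : {ffun A -> K} -> {ffun B -> K}) :
  piecewise_linear (geom S) F ->
  piecewise_linear (geom (cone_set S)) (cone_map F).
Proof.
move=> FP; have pC := polyhedron_realization (cone_set S).
apply: piecewise_linear_intro => // -[b|].
  apply: pl_fun_ext (pl_fun_cone (piecewise_linear_coord b FP)) => z _.
  by rewrite ffunE.
by apply: pl_fun_ext (pl_fun_coord None pC) => z _; rewrite ffunE.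
Qed.

End ConeHomeo.

Lemma cone_homeo d d' (A : finPOrderType d) (B : finPOrderType d')
    (S : {set A}) (S' : {set B}) F G :
  pl_homeo (geom S) (geom S') F G ->
  pl_homeo (geom (cone_set S)) (geom (cone_set S')) (cone_map F) (cone_map G).
Proof.
move=> [h1 h2 h3 h4]; split.
- move=> z Cz; split; first by apply: cone_map_into Cz => x /h1[].
  by apply: cone_mapK Cz => // x /h1[].
- move=> z Cz; split; first by apply: cone_map_into Cz => x /h2[].
  by apply: cone_mapK Cz => // x /h2[].
- exact: piecewise_linear_cone.
- exact: piecewise_linear_cone.
Qed.

End Realization.

(** * Points of a realization as step functions *)

Section Coupling.
Variable K : realType.
Local Notation geom S := (@realization K _ _ S%SET).

Section Masses.
Context (d : Order.disp_t) (A : finPOrderType d).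
Implicit Types (S : {set A}) (u : {ffun A -> K}).

Definition le_mass u (a : A) : K := \sum_(b | (b <= a)%O) u b.
Definition lt_mass u (a : A) : K := \sum_(b | (b < a)%O) u b.

Lemma le_massE u a : le_mass u a = lt_mass u a + u a.
Proof.
rewrite /le_mass (bigD1 a) //= addrC; congr (_ + _).
by apply: eq_bigl => b; rewrite lt_neqAle andbC.
Qed.

Section Chain.
Variables (E : {set A}) (u : {ffun A -> K}).
Hypothesis Eu : geom E u.

Let u0 a : 0 <= u a. Proof. by case: Eu. Qed.
Let u1 : \sum_a u a = 1. Proof. by case: Eu. Qed.
Let uE a : u a != 0 -> a \in E. Proof. by case: Eu => _ _ H _; apply: H. Qed.
Let uc a b : u a != 0 -> u b != 0 -> (a >=< b)%O.
Proof. by case: Eu => _ _ _ H; apply: H. Qed.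

Lemma lt_mass_ge0 a : 0 <= lt_mass u a.
Proof. by apply: sumr_ge0. Qed.

Lemma lt_mass_le a : lt_mass u a <= le_mass u a.
Proof. by rewrite le_massE lerDl. Qed.

Lemma le_mass_ge0 a : 0 <= le_mass u a.
Proof. exact: le_trans (lt_mass_ge0 a) (lt_mass_le a). Qed.

Lemma mass_le1 (p : pred A) : \sum_(a | p a) u a <= 1.
Proof.
by rewrite -u1 [leLHS]big_mkcond; apply: ler_sum => a _; case: ifP.
Qed.

Lemma le_mass_lt a b : (a < b)%O -> le_mass u a <= lt_mass u b.
Proof.
move=> ab; rewrite /le_mass /lt_mass [leLHS]big_mkcond [leRHS]big_mkcond.
apply: ler_sum => c _; case: ifP => [ca|_]; last by case: ifP.
by rewrite (le_lt_trans ca ab).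
Qed.

Lemma lt_mass_bot a : (forall b, b \in E -> (a <= b)%O) -> lt_mass u a = 0.
Proof.
move=> aE; apply: big1 => b ba; apply/eqP; apply: contraTT ba => /uE /aE ab.
by rewrite (le_gtF ab).
Qed.

Lemma le_mass_bot a : (forall b, b \in E -> (a <= b)%O) -> le_mass u a = u a.
Proof. by move=> aE; rewrite le_massE lt_mass_bot // add0r. Qed.

Lemma chain_max S : S != finset.set0 -> (forall a, a \in S -> u a != 0) ->
  exists2 m, m \in S & forall a, a \in S -> (a <= m)%O.
Proof.
move=> /finset.set0Pn[a0 a0S] Su.
case: (arg_maxnP (fun a => #|[set b in S | (b <= a)%O]|) a0S) => m mS max.
exists m => // a aS; have /orP[//|ma] := uc (Su _ aS) (Su _ mS).
(* If a were above m, more elements of S would lie below a than below m. *)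
have sub : [set b in S | (b <= m)%O] \subset [set b in S | (b <= a)%O].
  by apply/fintype.subsetP => b; rewrite !inE => /andP[-> /le_trans]; apply.
have /eqP E' : [set b in S | (b <= m)%O] == [set b in S | (b <= a)%O].
  by rewrite eqEcard sub; apply: max.
by have : a \in [set b in S | (b <= a)%O]; [rewrite inE aS lexx|rewrite -E' inE aS].
Qed.

(** Along the support of u, the values le_mass u and lt_mass u are the ends of
    consecutive intervals, so that the sum telescopes. *)
Lemma telescope_mass (k : K -> K) S :
  (forall a b, (a <= b)%O -> b \in S -> a \in S) ->
  \sum_(a in S) (k (le_mass u a) - k (lt_mass u a)) = k (\sum_(a in S) u a) - k 0.
Proof.
(* It suffices to consider subsets of the support, where the last term can be
   split off: the mass below the maximum m of T is the mass of T without m. *)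
have main n (T : {set A}) : #|T| = n -> (forall a, a \in T -> u a != 0) ->
    (forall a b, u a != 0 -> (a <= b)%O -> b \in T -> a \in T) ->
    \sum_(a in T) (k (le_mass u a) - k (lt_mass u a)) = k (\sum_(a in T) u a) - k 0.
  elim: n T => [|n IH] T cT Tu Td.
    by rewrite (cards0_eq cT) !big_set0 subrr.
  have [|m mT max] := chain_max (S := T) _ Tu; first by rewrite -card_gt0 cT.
  have ltm : lt_mass u m = \sum_(a in T :\ m) u a.
    rewrite /lt_mass big_mkcond [RHS]big_mkcond; apply: eq_bigr => a _.
    rewrite !inE; have [->|am] /= := eqVneq a m; first by rewrite ltxx.
    rewrite lt_neqAle am /=; have [->|ua] := eqVneq (u a) 0; first by rewrite !if_same.
    have [aT|aT] := boolP (a \in T); first by rewrite max.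
    by case: ifP => // /(Td _ _ ua) /(_ mT); rewrite (negPf aT).
  rewrite (big_setD1 m) //= [in RHS](big_setD1 m) //= IH.
  - rewrite -ltm le_massE [u m + _]addrC; ring.
  - by move: cT; rewrite (cardsD1 m) mT => -[].
  - by move=> a; rewrite inE => /andP[_ /Tu].
  - move=> a b ua ab; rewrite !inE => /andP[bm bT].
    rewrite (Td a b) // andbT; apply: contraNneq bm => am.
    by apply/eqP/le_anti; rewrite max //= -am.
move=> Sd; pose T := [set a in S | u a != 0].
have := main _ T (erefl _); have -> : \sum_(a in S) u a = \sum_(a in T) u a.
  rewrite big_mkcond [RHS]big_mkcond; apply: eq_bigr => a _.
  by rewrite inE; case: eqP => [->|]; rewrite ?if_same ?andbT.
move=> <-; last 2 first.
- by move=> a; rewrite inE => /andP[].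
- by move=> a b ua ab; rewrite !inE ua => /andP[/(Sd _ _ ab) ->].
rewrite big_mkcond [RHS]big_mkcond; apply: eq_bigr => a _.
rewrite inE; have [ua|] := eqVneq (u a) 0; last by rewrite andbT.
by rewrite andbF le_massE ua addr0 subrr if_same.
Qed.

Lemma telescope_le (k : K -> K) a :
  \sum_(b | (b <= a)%O) (k (le_mass u b) - k (lt_mass u b)) = k (le_mass u a) - k 0.
Proof.
have := @telescope_mass k [set b | (b <= a)%O].
have E' b : (b \in [set b | (b <= a)%O]) = (b <= a)%O by rewrite inE.
rewrite !(eq_bigl _ _ E') => -> // b c bc; rewrite !inE.
exact: le_trans.
Qed.

Lemma telescope_lt (k : K -> K) a :
  \sum_(b | (b < a)%O) (k (le_mass u b) - k (lt_mass u b)) = k (lt_mass u a) - k 0.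
Proof.
have := @telescope_mass k [set b | (b < a)%O].
have E' b : (b \in [set b | (b < a)%O]) = (b < a)%O by rewrite inE.
rewrite !(eq_bigl _ _ E') => -> // b c bc; rewrite !inE.
exact: le_lt_trans.
Qed.

Lemma telescope_all (k : K -> K) :
  \sum_b (k (le_mass u b) - k (lt_mass u b)) = k 1 - k 0.
Proof.
have := @telescope_mass k [set: A].
have E' b : (b \in [set: A]) = xpredT b by rewrite inE.
by rewrite !(eq_bigl _ _ E') u1 => -> // *; rewrite inE.
Qed.

End Chain.
End Masses.

(** * The realization of a product *)

(** The length of the intersection of the intervals [s, t] and [p, q] *)
Definition overlap (s t p q : K) : K := Num.max 0 (Num.min t q - Num.max s p).

Lemma overlap_ge0 s t p q : 0 <= overlap s t p q.
Proof. by rewrite /overlap le_max lexx. Qed.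

Lemma overlapC s t p q : overlap s t p q = overlap p q s t.
Proof. by rewrite /overlap [Num.min t q]minC [Num.max s p]maxC. Qed.

Definition clamp (s t z : K) : K := Num.max s (Num.min t z).

(** Written as an increment of a function of the endpoints of [p, q], overlaps
    with consecutive intervals telescope. *)
Lemma overlap_clamp s t p q : s <= t -> p <= q ->
  overlap s t p q = clamp s t q - clamp s t p.
Proof. by rewrite /overlap /clamp /Num.max /Num.min; do !case: ifP; lra. Qed.

Lemma overlap_le s t p q : s <= t -> overlap s t p q <= t - s.
Proof. by rewrite /overlap /Num.max /Num.min; do !case: ifP; lra. Qed.

Section CouplingDef.
Context (d d' : Order.disp_t) (A : finPOrderType d) (C : finPOrderType d').
Implicit Types (u : {ffun A -> K}) (v : {ffun C -> K}) (x : {ffun A *p C -> K}).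

Definition marg1 x : {ffun A -> K} := [ffun a => \sum_c x (a, c)].
Definition marg2 x : {ffun C -> K} := [ffun c => \sum_a x (a, c)].

(** Two points of |A| and |C| cut [0, 1] into consecutive intervals indexed by
    elements of A and of C; the pair (a, c) receives the length on which both
    step functions take these values. *)
Definition coupling u v : {ffun A *p C -> K} :=
  [ffun p => overlap (lt_mass u p.1) (le_mass u p.1) (lt_mass v p.2) (le_mass v p.2)].

Lemma sum_prod (F : A *p C -> K) (q : pred A) :
  \sum_(p : A *p C | q p.1) F p = \sum_(a | q a) \sum_c F (a, c).
Proof. by rewrite pair_big_dep /=; apply: eq_big => -[a c] //=; rewrite andbT. Qed.

Lemma sum_prod2 (F : A *p C -> K) (q : pred C) :
  \sum_(p : A *p C | q p.2) F p = \sum_(c | q c) \sum_a F (a, c).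
Proof. by rewrite exchange_big /= pair_big_dep /=; apply: eq_big => -[a c]. Qed.

Definition pset (S : {set A}) (T : {set C}) : {set A *p C} :=
  [set p : A *p C | (p.1 \in S) && (p.2 \in T)].

Section UV.
Variables (S : {set A}) (T : {set C}) (u : {ffun A -> K}) (v : {ffun C -> K}).
Hypotheses (Su : geom S u) (Tv : geom T v).

Lemma marg1_coupling : marg1 (coupling u v) = u.
Proof.
apply/ffunP => a; rewrite ffunE.
under eq_bigr => c _ do rewrite ffunE (overlap_clamp (lt_mass_le Su a) (lt_mass_le Tv c)).
rewrite (telescope_all Tv (clamp (lt_mass u a) (le_mass u a))).
have := lt_mass_ge0 Su a; have := mass_le1 Su (fun b => (b <= a)%O).
rewrite -/(le_mass u a) le_massE; have : 0 <= u a by case: Su.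
by rewrite /clamp /Num.max /Num.min; do !case: ifP; lra.
Qed.

Lemma marg2_coupling : marg2 (coupling u v) = v.
Proof.
apply/ffunP => c; rewrite ffunE.
under eq_bigr => a _ do rewrite ffunE overlapC (overlap_clamp (lt_mass_le Tv c) (lt_mass_le Su a)).
rewrite (telescope_all Su (clamp (lt_mass v c) (le_mass v c))).
have := lt_mass_ge0 Tv c; have := mass_le1 Tv (fun b => (b <= c)%O).
rewrite -/(le_mass v c) le_massE; have : 0 <= v c by case: Tv.
by rewrite /clamp /Num.max /Num.min; do !case: ifP; lra.
Qed.

Lemma coupling_neq0 p : coupling u v p != 0 -> u p.1 != 0 /\ v p.2 != 0.
Proof.
rewrite ffunE; set o := overlap _ _ _ _ => o0.
have o_gt0 : 0 < o by rewrite lt_neqAle eq_sym o0 overlap_ge0.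
have o1 : o <= u p.1.
  by apply: le_trans (overlap_le _ _ (lt_mass_le Su _)) _; rewrite le_massE addrC addKr.
have o2 : o <= v p.2.
  rewrite /o overlapC; apply: le_trans (overlap_le _ _ (lt_mass_le Tv _)) _.
  by rewrite le_massE addrC addKr.
by split; rewrite gt_eqF // (lt_le_trans o_gt0).
Qed.

(** In both partitions of [0, 1] smaller elements own earlier intervals, so two
    pairs that both overlap are never ordered oppositely; this is why the coupling
    is supported on a chain. *)
Lemma coupling_no_cross a a' c c' :
  coupling u v (a, c) != 0 -> coupling u v (a', c') != 0 ->
  (a < a')%O -> (c' < c)%O -> False.
Proof.
move=> n n' /(le_mass_lt Su) aa /(le_mass_lt Tv) cc.
have : 0 < coupling u v (a, c) by rewrite lt_neqAle eq_sym n ffunE overlap_ge0.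
have : 0 < coupling u v (a', c') by rewrite lt_neqAle eq_sym n' ffunE overlap_ge0.
rewrite !ffunE /=; move: aa cc.
by rewrite /overlap /Num.max /Num.min; do !case: ifP; lra.
Qed.

Lemma realization_coupling : geom (pset S T) (coupling u v).
Proof.
split.
- by move=> p; rewrite ffunE overlap_ge0.
- rewrite (sum_prod _ xpredT) -[RHS](let: And4 _ H _ _ := Su in H).
  by apply: eq_bigr => a _; rewrite -[in RHS]marg1_coupling ffunE.
- move=> p /coupling_neq0[up vp]; rewrite inE.
  by case: Su Tv => _ _ -> // _ [_ _ -> // _].
- move=> [a c] [a' c'] n n'.
  have [ua vc] := coupling_neq0 n; have [ua' vc'] := coupling_neq0 n'.
  have ca : (a >=< a')%O by case: Su => _ _ _; apply.
  have cc : (c >=< c')%O by case: Tv => _ _ _; apply.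
  have [e|ne] := eqVneq a a'.
    by subst a'; move: cc => /orP[] h; apply/orP; [left|right]; rewrite leEprod lexx.
  have [e|ne'] := eqVneq c c'.
    by subst c'; move: ca => /orP[] h; apply/orP; [left|right]; rewrite leEprod /= h lexx.
  case/orP: ca => ha; case/orP: cc => hc.
  + by apply/orP; left; rewrite leEprod ha.
  + by case: (coupling_no_cross n n'); rewrite lt_neqAle ?ne ?ha // eq_sym ne'.
  + case: (coupling_no_cross n' n); rewrite lt_neqAle ?ne' ?hc ?ha //=.
    by rewrite eq_sym ne.
  + by apply/orP; right; rewrite leEprod ha.
Qed.

(** Both intervals start at 0, so one contains the other. *)
Lemma coupling_bot a c : (forall b, b \in S -> (a <= b)%O) -> (forall e, e \in T -> (c <= e)%O) ->
  coupling u v (a, c) = Num.min (u a) (v c).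
Proof.
move=> aS cT; rewrite ffunE /= (lt_mass_bot Su) // (lt_mass_bot Tv) // (le_mass_bot Su) //.
rewrite (le_mass_bot Tv) // /overlap maxxx subr0.
by apply/max_idPr; rewrite le_min; case: Su Tv => + _ _ _ [+ _ _ _] => -> ->.
Qed.

End UV.

Section X.
Variables (S : {set A}) (T : {set C}) (x : {ffun A *p C -> K}).
Hypothesis STx : geom (pset S T) x.

Let x0 p : 0 <= x p. Proof. by case: STx. Qed.

Lemma marg1_neq0 a : marg1 x a != 0 -> exists c, x (a, c) != 0.
Proof. by rewrite ffunE => /sum_neq0[c _]; exists c. Qed.

Lemma marg2_neq0 c : marg2 x c != 0 -> exists a, x (a, c) != 0.
Proof. by rewrite ffunE => /sum_neq0[a _]; exists a. Qed.

Lemma realization_marg1 : geom S (marg1 x).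
Proof.
case: STx => _ x1 xS xc; split.
- by move=> a; rewrite ffunE sumr_ge0.
- under eq_bigr do rewrite ffunE.
  by rewrite -(sum_prod _ xpredT).
- by move=> a /marg1_neq0[c /xS]; rewrite inE => /andP[].
- move=> a b /marg1_neq0[c xa] /marg1_neq0[e xb].
  by have /orP[] := xc _ _ xa xb; rewrite leEprod => /andP[/= h _]; apply/orP; [left|right].
Qed.

Lemma realization_marg2 : geom T (marg2 x).
Proof.
case: STx => _ x1 xS xc; split.
- by move=> a; rewrite ffunE sumr_ge0.
- under eq_bigr do rewrite ffunE.
  by rewrite -(sum_prod2 _ xpredT).
- by move=> a /marg2_neq0[c /xS]; rewrite inE => /andP[].
- move=> a b /marg2_neq0[c xa] /marg2_neq0[e xb].
  by have /orP[] := xc _ _ xa xb; rewrite leEprod => /andP[_ /= h]; apply/orP; [left|right].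
Qed.

(** On the support, an element with a smaller first coordinate is smaller in
    A x C, by comparability; so the interval of p starts no earlier than those of
    its coordinates. *)
Lemma lt_mass_marg (p : A *p C) : x p != 0 ->
  lt_mass (marg1 x) p.1 <= lt_mass x p /\ lt_mass (marg2 x) p.2 <= lt_mass x p.
Proof.
move=> xp; case: STx => _ _ _ xc; split.
- rewrite /lt_mass; under eq_bigr do rewrite ffunE.
  rewrite -(sum_prod x (fun b => (b < p.1)%O)) [leLHS]big_mkcond [leRHS]big_mkcond.
  apply: ler_sum => q _; case: ifP => [qp|_]; last by case: ifP.
  have [->|xq] := eqVneq (x q) 0; first by rewrite if_same.
  suff -> : (q < p)%O by [].
  have npq : ~~ (p <= q)%O by rewrite leEprod (lt_geF qp).
  have /orP[h|h] := xc _ _ xq xp; last by rewrite h in npq.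
  by rewrite lt_neqAle h andbT; apply: contraNneq npq => ->.
- rewrite /lt_mass; under eq_bigr do rewrite ffunE.
  rewrite -(sum_prod2 x (fun b => (b < p.2)%O)) [leLHS]big_mkcond [leRHS]big_mkcond.
  apply: ler_sum => q _; case: ifP => [qp|_]; last by case: ifP.
  have [->|xq] := eqVneq (x q) 0; first by rewrite if_same.
  suff -> : (q < p)%O by [].
  have npq : ~~ (p <= q)%O by rewrite leEprod (lt_geF qp) andbF.
  have /orP[h|h] := xc _ _ xq xp; last by rewrite h in npq.
  by rewrite lt_neqAle h andbT; apply: contraNneq npq => ->.
Qed.

Lemma le_mass_marg (p : A *p C) :
  le_mass x p <= le_mass (marg1 x) p.1 /\ le_mass x p <= le_mass (marg2 x) p.2.
Proof.
split.
- rewrite /le_mass; under [leRHS]eq_bigr do rewrite ffunE.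
  rewrite -(sum_prod x (fun b => (b <= p.1)%O)) [leLHS]big_mkcond [leRHS]big_mkcond.
  apply: ler_sum => q _; case: ifP => [|_]; last by case: ifP.
  by rewrite leEprod => /andP[->].
- rewrite /le_mass; under [leRHS]eq_bigr do rewrite ffunE.
  rewrite -(sum_prod2 x (fun b => (b <= p.2)%O)) [leLHS]big_mkcond [leRHS]big_mkcond.
  apply: ler_sum => q _; case: ifP => [|_]; last by case: ifP.
  by rewrite leEprod => /andP[_ ->].
Qed.

(** Each point of the support contributes an interval of length x p, which
    lies in both intervals that its coordinates contribute to the marginals;
    as the lengths add up to 1 on both sides, nothing is left over. *)
Lemma coupling_marg : coupling (marg1 x) (marg2 x) = x.
Proof.
have S1 := realization_marg1; have T2 := realization_marg2.
have le p : x p <= coupling (marg1 x) (marg2 x) p.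
  have [->|xp] := eqVneq (x p) 0; first by rewrite ffunE overlap_ge0.
  have [] := lt_mass_marg xp; have [] := le_mass_marg p.
  rewrite le_massE ffunE.
  by rewrite /overlap /Num.max /Num.min; do !case: ifP; lra.
have [_ s1 _ _] := realization_coupling S1 T2; have [_ s2 _ _] := STx.
apply/ffunP => p; apply/eqP; rewrite -subr_eq0.
have := subrr (1 : K); rewrite -{1}s1 -s2 -sumrB => /eqP.
rewrite psumr_eq0; last by move=> q _; rewrite subr_ge0.
by move=> /allP /(_ p); rewrite mem_index_enum => /(_ isT).
Qed.

End X.

Lemma affine_marg1 a : affine_fun (fun x => marg1 x a).
Proof.
have [m [e mE]] : affine_fun (fun x : {ffun A *p C -> K} => \sum_c x (a, c)).
  by apply: affine_sum => c; apply: affine_coord.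
by exists m, e => x; rewrite ffunE mE.
Qed.

Lemma affine_marg2 c : affine_fun (fun x => marg2 x c).
Proof.
have [m [e mE]] : affine_fun (fun x : {ffun A *p C -> K} => \sum_a x (a, c)).
  by apply: affine_sum => a; apply: affine_coord.
by exists m, e => x; rewrite ffunE mE.
Qed.

End CouplingDef.

Lemma pl_fun_le_mass (I : finType) (X : set {ffun I -> K}) d (A : finPOrderType d)
    (F : {ffun I -> K} -> {ffun A -> K}) a : polyhedron X ->
  (forall b, pl_fun X (fun x => F x b)) -> pl_fun X (fun x => le_mass (F x) a).
Proof. by move=> pX FP; apply: pl_fun_sum. Qed.

Lemma pl_fun_lt_mass (I : finType) (X : set {ffun I -> K}) d (A : finPOrderType d)
    (F : {ffun I -> K} -> {ffun A -> K}) a : polyhedron X ->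
  (forall b, pl_fun X (fun x => F x b)) -> pl_fun X (fun x => lt_mass (F x) a).
Proof. by move=> pX FP; apply: pl_fun_sum. Qed.

Lemma pl_coupling (I : finType) (X : set {ffun I -> K}) d d'
    (A : finPOrderType d) (C : finPOrderType d')
    (F : {ffun I -> K} -> {ffun A -> K}) (G : {ffun I -> K} -> {ffun C -> K}) :
  polyhedron X -> (forall a, pl_fun X (fun x => F x a)) ->
  (forall c, pl_fun X (fun x => G x c)) ->
  piecewise_linear X (fun x => coupling (F x) (G x)).
Proof.
move=> pX FP GP; apply: piecewise_linear_intro => // p.
apply: pl_fun_ext (_ : pl_fun X (fun x => overlap (lt_mass (F x) p.1)
  (le_mass (F x) p.1) (lt_mass (G x) p.2) (le_mass (G x) p.2))).
  by move=> x _; rewrite ffunE.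
apply: pl_fun_max; first exact: pl_fun_cst.
apply: pl_fun_add; first by apply: pl_fun_min; apply: pl_fun_le_mass.
by apply: pl_fun_opp; apply: pl_fun_max; apply: pl_fun_lt_mass.
Qed.

Section ProductHomeo.
Context (d d' e : Order.disp_t) (A : finPOrderType d) (B : finPOrderType d').
Context (C : finPOrderType e).

(** The map F x id under the identification of |A x C| with |A| x |C| *)
Definition prod_map (F : {ffun A -> K} -> {ffun B -> K}) (x : {ffun A *p C -> K}) :
  {ffun B *p C -> K} := coupling (F (marg1 x)) (marg2 x).

Lemma piecewise_linear_prod (S : {set A}) (T : {set C}) F :
  piecewise_linear (geom S) F -> piecewise_linear (geom (pset S T)) (prod_map F).
Proof.
move=> FP; have pX := polyhedron_realization K (pset S T).
apply: pl_coupling => // [b|c]; last first.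
  by apply: pl_fun_affine => //; apply: affine_marg2.
apply: (pl_fun_comp (Y := geom S)) (piecewise_linear_coord b FP).
  by apply: piecewise_linear_intro => // a; apply: pl_fun_affine => //; apply: affine_marg1.
by move=> x /realization_marg1.
Qed.

Lemma prod_map_marg (S : {set B}) (T : {set C}) (F : {ffun A -> K} -> {ffun B -> K}) x :
  geom S (F (marg1 x)) -> geom T (marg2 x) ->
  marg1 (prod_map F x) = F (marg1 x) /\ marg2 (prod_map F x) = marg2 x.
Proof.
by move=> h1 h2; rewrite /prod_map (marg1_coupling h1 h2) (marg2_coupling h1 h2).
Qed.

End ProductHomeo.

Lemma prod_homeo d d' e (A : finPOrderType d) (B : finPOrderType d') (C : finPOrderType e)
   (S : {set A}) (S' : {set B}) (T : {set C}) F G :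
  pl_homeo (geom S) (geom S') F G ->
  pl_homeo (geom (pset S T)) (geom (pset S' T)) (prod_map F) (prod_map G).
Proof.
move=> [h1 h2 h3 h4]; split; [| |exact: piecewise_linear_prod|exact: piecewise_linear_prod].
- move=> x Xx; have x1 := realization_marg1 Xx; have x2 := realization_marg2 Xx.
  have [Fx FK] := h1 _ x1; split; first exact: realization_coupling.
  have [m1 m2] := prod_map_marg Fx x2.
  by rewrite {1}/prod_map m1 m2 FK (coupling_marg Xx).
- move=> x Xx; have x1 := realization_marg1 Xx; have x2 := realization_marg2 Xx.
  have [Fx FK] := h2 _ x1; split; first exact: realization_coupling.
  have [m1 m2] := prod_map_marg Fx x2.
  by rewrite {1}/prod_map m1 m2 FK (coupling_marg Xx).
Qed.

End Coupling.

(** * Products with a poset that has a greatest element *)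

Section Collars.
Variable K : realType.
Local Notation geom S := (@realization K _ _ S%SET).

Lemma push_incl (d d' : Order.disp_t) (B : finPOrderType d) (D : finPOrderType d')
    (E : {set B}) (i : B -> cone D) (y : {ffun B -> K}) (x : {ffun D -> K}) :
  {in E &, injective i} ->
  (forall b, b \in E -> y b = if i b is Some q then x q else 0) ->
  (forall q, x q != 0 -> (Some q : cone D) \in i @: E) -> push E i y = cone_incl x.
Proof.
move=> i_inj yE xE; apply/ffunP => c.
have [/imsetP[b bE ->]|cE] := boolP (c \in i @: E).
  by rewrite pushE // yE // ffunE; case: (i b).
rewrite push_out // ffunE; case: c cE => //= q qE.
by apply/esym/eqP; apply: contraNT qE => /xE.
Qed.

Lemma homeo_to_cone_intro (d : Order.disp_t) (A : finPOrderType d) (E D : {set A}) F G :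
  pl_homeo (geom E) (geom (cone_set D)) F G ->
  (forall x, geom D x -> F x = cone_incl x) -> homeo_to_cone K E D.
Proof. by move=> FG FD; exists F; split=> //; exists G. Qed.

Section Faces.
Context (d e : Order.disp_t) (A : finPOrderType d) (C : finPOrderType e).
Variables (S S0 : {set A}) (T : {set C}) (c : C).
Hypotheses (S0_closed : closed_in S0 S) (c_top : forall t, t \in T -> (t <= c)%O).

Lemma marg_neq0 (x : {ffun A *p C -> K}) p : (forall q, 0 <= x q) -> x p != 0 ->
  marg1 x p.1 != 0 /\ marg2 x p.2 != 0.
Proof.
move=> x0 xp; case: p xp => a t xp; rewrite /= !ffunE; split; apply: contraNneq xp.
  move=> /eqP; rewrite psumr_eq0 // => /allP /(_ t).
  by rewrite mem_index_enum => /(_ isT).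
move=> /eqP; rewrite psumr_eq0 // => /allP /(_ a).
by rewrite mem_index_enum => /(_ isT).
Qed.

(** The realization of the union of S0 x T and S x (T - c) is the union of |S0 x T|
    and |S x (T - c)|: once a chain has reached the top c of T, closedness of S0
    keeps all of its first coordinates in S0. *)
Lemma realization_faces (x : {ffun A *p C -> K}) : geom (pset S T) x ->
  (forall p, x p != 0 -> (p.1 \in S0) || (p.2 != c)) <->
  (geom S0 (marg1 x) \/ marg2 x c = 0).
Proof.
move=> /[dup] STx [x0 _ xST xc]; split; last first.
  move=> [[_ _ S0x _]|xc0] p xp; have [m1 m2] := marg_neq0 x0 xp.
    by rewrite S0x.
  by apply/orP; right; apply: contraNneq m2 => ->; rewrite xc0.
move=> xW; have [->|/marg2_neq0[a' xa']] := eqVneq (marg2 x c) 0; first by right.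
left; apply: realization_intro (realization_marg1 STx) _ => a /marg1_neq0[t xa].
have := xW _ xa; have := xW _ xa'; rewrite /= eqxx orbF => a'S0.
have := xST _ xa; rewrite inE => /andP[/= aS tT].
have [_|tc _] := eqVneq t c; first by rewrite orbF.
have /orP[|] := xc _ _ xa xa'; rewrite leEprod /= => /andP[h1 h2].
  by case: S0_closed => _; apply; first exact: aS; last exact: h1.
by case/eqP: tc; apply: le_anti; rewrite h2 c_top.
Qed.

End Faces.

Section Product.
Context (d e : Order.disp_t) (A : finPOrderType d) (C : finPOrderType e).
Variables (S S0 : {set A}) (T : {set C}) (c : C) (N : {set A *p C}).
Variables (F : {ffun A -> K} -> {ffun cone A -> K}) (G : {ffun cone A -> K} -> {ffun A -> K}).
Hypotheses (S0_closed : closed_in S0 S) (c_in : c \in T)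
  (c_top : forall t, t \in T -> (t <= c)%O)
  (FG : pl_homeo (geom S) (geom (cone_set S0)) F G)
  (F_rel : forall x, geom S0 x -> F x = cone_incl x)
  (N_bot : forall p, p \in N -> [/\ p.1 \in S0, forall a, a \in S -> (p.1 <= a)%O,
     forall t, t \in T -> (p.2 <= t)%O &
     forall x, geom S x -> F x (Some p.1) = x p.1]).

Let W := pset S T :\: N.
Let W0 := [set p in W | (p.1 \in S0) || (p.2 != c)].
Let N' := [set p : cone A *p C | if p.1 is Some a then (a, p.2) \in N else false].
Let V := pset (cone_set S0) T :\: N'.
Let V0 := [set p in V | (p.1 \in cone_set S0 :\ None) || (p.2 != c)].

Let WP x : geom W x <-> geom (pset S T) x /\ forall p, p \in N -> x p = 0.
Proof.
split=> [Wx|[Sx xN]].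
  split=> [|p pN]; first by apply: realization_sub Wx; apply: finset.subsetDl.
  by apply: realization_out Wx _; rewrite inE pN.
apply: (realization_intro Sx) => p xp; rewrite inE.
case: Sx => _ _ -> // _; rewrite andbT.
by apply: contra xp => /xN ->.
Qed.

Let VP x : geom V x <-> geom (pset (cone_set S0) T) x /\
  forall p, p \in N -> x (Some p.1, p.2) = 0.
Proof.
split=> [Wx|[Sx xN]].
  split=> [|p pN]; first by apply: realization_sub Wx; apply: finset.subsetDl.
  by apply: realization_out Wx _; rewrite !inE /= -surjective_pairing pN.
apply: (realization_intro Sx) => p xp; rewrite inE.
case: Sx => _ _ -> // _; rewrite andbT inE; case: p xp => -[a|] t //=.
by apply: contra => /xN /= ->.
Qed.

Let W0P x : geom W0 x <-> geom W x /\ (geom S0 (marg1 x) \/ marg2 x c = 0).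
Proof.
split=> [W0x|[Wx xf]].
  have Wx : geom W x.
    by apply: realization_sub W0x; apply/fintype.subsetP => p; rewrite inE => /andP[].
  split=> //; apply/(realization_faces S0_closed c_top (proj1 (proj1 (WP x) Wx))).
  by case: W0x => _ _ H _ p /H; rewrite inE => /andP[].
apply: (realization_intro Wx) => p xp; rewrite inE.
have /WP[Sx _] := Wx; have := proj2 (realization_faces S0_closed c_top Sx) xf _ xp.
by move=> ->; rewrite andbT; case: Wx => _ _ ->.
Qed.

Let cone_closed : closed_in (cone_set S0 :\ None) (cone_set S0).
Proof.
split=> [|a b]; first exact: finset.subsetDl.
by rewrite !inE => aS /andP[bN bS] ab; rewrite aS andbT; case: a b bN {aS bS} ab => [a|] [b|].
Qed.

Let V0P x : geom V0 x <-> geom V x /\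
  (geom (cone_set S0 :\ None) (marg1 x) \/ marg2 x c = 0).
Proof.
split=> [W0x|[Wx xf]].
  have Wx : geom V x.
    by apply: realization_sub W0x; apply/fintype.subsetP => p; rewrite inE => /andP[].
  split=> //; apply/(realization_faces cone_closed c_top (proj1 (proj1 (VP x) Wx))).
  by case: W0x => _ _ H _ p /H; rewrite inE => /andP[].
apply: (realization_intro Wx) => p xp; rewrite inE.
have /VP[Sx _] := Wx; have := proj2 (realization_faces cone_closed c_top Sx) xf _ xp.
by move=> ->; rewrite andbT; case: Wx => _ _ ->.
Qed.

Let STF : pl_homeo (geom (pset S T)) (geom (pset (cone_set S0) T)) (prod_map F) (prod_map G).
Proof. exact: prod_homeo. Qed.

(** The coordinate at a bottom element of a product is the minimum of the two
    coordinates, so it is preserved if F preserves the one of its argument. *)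
Let prod_map_bot x p : geom (pset S T) x -> p \in N ->
  prod_map F x (Some p.1, p.2) = x p.
Proof.
move=> STx /N_bot[pS0 pS pT Fp].
have x1 := realization_marg1 STx; have x2 := realization_marg2 STx.
have Fx : geom (cone_set S0) (F (marg1 x)) by case: FG => /(_ _ x1) [].
rewrite /prod_map (coupling_bot Fx x2) //; last first.
  case=> // a; rewrite cone_set_Some => aS0; apply: pS.
  by case: S0_closed => /fintype.subsetP /(_ _ aS0).
rewrite Fp // -[in RHS](coupling_marg STx) [in RHS](surjective_pairing p).
by rewrite (coupling_bot x1 x2).
Qed.

Let WV : pl_homeo (geom W) (geom V) (prod_map F) (prod_map G).
Proof.
apply: pl_homeo_restrict STF _ _ _ _; [exact: polyhedron_realization..| |].
- move=> x /WP[Sx xN]; split=> //; apply/VP; split; first by case: STF => /(_ _ Sx) [].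
  by move=> p pN; rewrite prod_map_bot // xN.
- move=> y /VP[Sy yN]; split=> //; apply/WP.
  case: STF => _ /(_ _ Sy) [Sx E] _ _; split=> // p pN.
  by rewrite -prod_map_bot // E yN.
Qed.

(** A point that F sends to the base |S0| of the cone is the point of |S0| with the
    same coordinates, as F is injective and fixes |S0|. *)
Let F_faces u : geom S u -> geom S0 u <-> geom (cone_set S0 :\ None) (F u).
Proof.
move=> Su; have Cu : geom (cone_set S0) (F u) by case: FG => /(_ _ Su) [].
split=> [S0u|CFu].
  apply: (realization_intro Cu) => -[a|] //; rewrite F_rel // ffunE /=.
    by move=> ua; rewrite in_setD1 cone_set_Some; case: S0u => _ _ ->.
  by rewrite eqxx.
pose w := [ffun a => F u (Some a)].
have FN : F u None = 0 by apply: realization_out CFu _; rewrite !inE eqxx.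
have S0w : geom S0 w.
  have := realization_cone_base Cu; rewrite FN eq_sym oner_eq0 => /(_ isT).
  by congr (geom S0); apply/ffunP => a; rewrite !ffunE FN subr0 divr1.
have Sw : geom S w by apply: realization_sub S0w; case: S0_closed.
have E : F u = F w.
  rewrite (F_rel S0w); apply/ffunP => -[a|]; rewrite ffunE /= ?ffunE //.
by case: FG => H _ _ _; have [_ <-] := H _ Su; rewrite E; have [_ ->] := H _ Sw.
Qed.

Let prod_map_faces x : geom W x -> geom W0 x <-> geom V0 (prod_map F x).
Proof.
move=> Wx; have /WP[STx _] := Wx; have Vx : geom V (prod_map F x) by case: WV => /(_ _ Wx) [].
have x1 := realization_marg1 STx; have x2 := realization_marg2 STx.
have Fx : geom (cone_set S0) (F (marg1 x)) by case: FG => /(_ _ x1) [].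
have [m1 m2] := prod_map_marg Fx x2.
have ff := F_faces x1.
split=> [/W0P[_ h]|/V0P[_ h]]; first by apply/V0P; rewrite m1 m2; split=> //; case: h; tauto.
by apply/W0P; split=> //; move: h; rewrite m1 m2; tauto.
Qed.

Let W0V0 : pl_homeo (geom W0) (geom V0) (prod_map F) (prod_map G).
Proof.
apply: pl_homeo_restrict WV _ _ _ _; [exact: polyhedron_realization..| |].
- by move=> x /[dup] W0x /W0P[Wx _]; split=> //; apply/prod_map_faces.
- move=> y /[dup] V0y /V0P[Vy _]; split=> //.
  by case: WV => _ /(_ _ Vy) [Wx E] _ _; apply/prod_map_faces; rewrite ?E.
Qed.

(** The poset C S0 x T has the greatest element (None, c). *)
Let i (p : cone A *p C) : cone (cone A *p C) :=
  if p == (None, c) then None else Some p.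

Let i_inj : {in V &, injective i}.
Proof.
move=> p q _ _; rewrite /i; case: eqP => [->|_]; case: eqP => [->|_] //.
by case.
Qed.

Let V_top p : p \in V -> (p <= ((None, c) : cone A *p C))%O.
Proof.
by rewrite !inE => /and3P[_ _ /c_top pc]; rewrite leEprod /= pc andbT; case: (p.1).
Qed.

Let i_comp : {in V &, forall p q, (i p >=< i q)%O = (p >=< q)%O}.
Proof.
move=> p q pV qV; rewrite cone_comparable /i; case: eqP => [->|_].
  by rewrite /Order.comparable (V_top qV) orbT.
by case: eqP => [->|_] //; rewrite /Order.comparable (V_top pV).
Qed.

Let top_V : ((None, c) : cone A *p C) \in V.
Proof. by rewrite inE; apply/andP; split; rewrite inE /= ?cone_set_None. Qed.

Let V0E p : (p \in V0) = (p \in V) && (p != (None, c)).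
Proof.
rewrite inE; have [|//] := boolP (p \in V).
rewrite finset.in_setD => /andP[_]; rewrite inE => /andP[aS _] /=.
by case: p aS => a t /= aS; rewrite in_setD1 aS andbT xpair_eqE negb_and.
Qed.

Let i_image : i @: V = cone_set V0.
Proof.
apply/setP => q; apply/imsetP/idP => [[p pV ->]|].
  rewrite /i; case: eqP => [_|/eqP pn]; first exact: cone_set_None.
  by rewrite cone_set_Some V0E pV.
case: q => [p|_]; last by exists (None, c); rewrite // /i eqxx.
by rewrite cone_set_Some V0E => /andP[pV pn]; exists p; rewrite // /i (negPf pn).
Qed.

(** The poset V is the cone over V0, the homeomorphism from |W| to |V| restricts to
    one from |W0| to |V0|, and coning the inverse of the latter turns |V| = |C V0|
    into |C W0| and makes the composite the identity on |W0|.  For a link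
    below the top of T, N consists of the bottom element of S x T. *)
Lemma homeo_to_cone_prod :
  homeo_to_cone K (pset S T :\: N)
    [set p in pset S T :\: N | (p.1 \in S0) || (p.2 != c)].
Proof.
have VC : pl_homeo (geom V) (geom (cone_set V0)) (push V i) (pull V i).
  by rewrite -i_image; apply: realization_iso.
apply: (homeo_to_cone_intro (pl_homeo_comp WV (pl_homeo_comp VC
  (cone_homeo (pl_homeo_sym W0V0))))) => x W0x /=.
have [V0y GF] : geom V0 (prod_map F x) /\ prod_map G (prod_map F x) = x.
  by case: W0V0 => /(_ _ W0x).
rewrite (push_incl (x := prod_map F x)) ?cone_map_incl ?GF //.
- move=> p pV; rewrite /i; case: eqP => [->|//].
  by apply: realization_out V0y _; rewrite V0E eqxx andbF.
- by move=> q yq; rewrite i_image cone_set_Some; case: V0y => _ _ ->.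
Qed.

End Product.
End Collars.

(** * The link of the bottom element of a product *)

(** Let S have the bottom element a, and let T have the bottom element g and the
    top element c, with g different from c.  A point of |S x T| without the bottom
    (a, g) is a pair u, v of points of |S| and |T| with min (u a) (v g) = 0.  The
    cone over the part W0 below c is a subposet of C S x T, and a point of its
    realization is a pair of points of |C S| and |T| that have the same mass at
    the tops None and c, with a similar minimum equal to 0.  So u, of total mass
    1, has to give up as much mass to None as v keeps at c, and multiplying u by
    a factor that depends on v would not be piecewise linear.

    Put m = u a and s = v c.  First a gives up min m s.  If s > m, the next s - m
    of the mass of u, following its step function upwards from a, is halved and
    thus gives up r = (s - m) / 2; at the same time v moves the mass r from c to
    g.  Then u has given up s - r in all, which is what v keeps at c.  Nothing
    happens if s = 0, so the map fixes |W0|.  In terms of step functions, u is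
    reparametrized by the function squeeze m s on [0, 1], which has the inverse
    stretch m (s - r) on [m, 1], and r is shift_amount m s.  From the result r is recovered as the
    minimum of the new masses of v at c and g. *)

Section BottomProduct.
Variable K : realType.
Local Notation geom S := (@realization K _ _ S%SET).

Definition shift_amount (m s : K) : K := 2^-1 * Num.max 0 (s - m).
Definition squeeze (m s z : K) : K :=
  Num.max 0 (Num.max (2^-1 * (z - m)) (z - (s - shift_amount m s))).
Definition stretch (m s z : K) : K := Num.min (2 * z + m) (z + s).

Ltac minmax := rewrite /squeeze /stretch /shift_amount /Num.max /Num.min; do !case: ifP; lra.

Lemma squeeze0 m s : 0 <= m -> 0 <= s -> squeeze m s 0 = 0.
Proof. by minmax. Qed.

Lemma squeeze1 m s : 0 <= m -> 0 <= s <= 1 -> squeeze m s 1 = 1 - (s - shift_amount m s).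
Proof. by minmax. Qed.

Lemma squeeze_le m s z w : z <= w -> squeeze m s z <= squeeze m s w.
Proof. by minmax. Qed.

Lemma stretch_le m s z w : z <= w -> stretch m s z <= stretch m s w.
Proof. by minmax. Qed.

Lemma shift_amount_ge0 m s : 0 <= shift_amount m s.
Proof. by minmax. Qed.

Lemma shift_amount_le m s : 0 <= m -> 0 <= s -> shift_amount m s <= s.
Proof. by minmax. Qed.

Lemma squeeze_id m z : 0 <= m -> 0 <= z -> squeeze m 0 z = z.
Proof. by minmax. Qed.

Lemma squeezeK m s z : 0 <= m <= z -> 0 <= s ->
  stretch m (s - shift_amount m s) (squeeze m s z) = z.
Proof. by minmax. Qed.

Lemma shift_amountK m s g : 0 <= m -> 0 <= s -> Num.min m g = 0 ->
  Num.min (s - shift_amount m s) (g + shift_amount m s) = shift_amount m s.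
Proof. by minmax. Qed.

Lemma squeeze_bot m s : 0 <= m -> 0 <= s ->
  squeeze m s m + (s - shift_amount m s) - shift_amount m s = m.
Proof. by minmax. Qed.

Lemma squeeze_min m s g : 0 <= m -> 0 <= s -> Num.min m g = 0 ->
  Num.min (squeeze m s m) (g + shift_amount m s) = 0.
Proof. by minmax. Qed.

Lemma sum_pred1 (I : finType) (i : I) : \sum_j (j == i)%:R = 1 :> K.
Proof. by rewrite (bigD1 i) //= eqxx big1 ?addr0 // => j /negPf ->. Qed.

(* The point to be recovered has the mass m at a; n, s and g are the masses that
   are left at a, at the tops and at g. *)
Section Inverse.
Variables (n s g : K).
Hypotheses (n0 : 0 <= n) (s0 : 0 <= s) (g0 : 0 <= g) (sg1 : s + g <= 1)
  (ng : Num.min n g = 0).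
Let m := n + s - Num.min s g.

Lemma stretch0_ge0 : 0 <= stretch m s 0.
Proof. by move: n0 s0 g0 sg1 ng; rewrite /m; minmax. Qed.

Lemma stretch1 : stretch m s (1 - s) = 1.
Proof. by move: n0 s0 g0 sg1 ng; rewrite /m; minmax. Qed.

Lemma stretch_bot : stretch m s n = m.
Proof. by move: n0 s0 g0 sg1 ng; rewrite /m; minmax. Qed.

Lemma stretch_min : Num.min m (g - Num.min s g) = 0.
Proof. by move: n0 s0 g0 sg1 ng; rewrite /m; minmax. Qed.

Lemma shift_amount_stretch : shift_amount m (s + Num.min s g) = Num.min s g.
Proof. by move: n0 s0 g0 sg1 ng; rewrite /m; minmax. Qed.

Lemma stretchK z : 0 <= z -> squeeze m (s + Num.min s g) (stretch m s z) = z.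
Proof. by move: n0 s0 g0 sg1 ng; rewrite /m; minmax. Qed.

Lemma squeeze_start : squeeze m (s + Num.min s g) 0 = 0.
Proof. by move: n0 s0 g0 sg1 ng; rewrite /m; minmax. Qed.

End Inverse.

Context (d e : Order.disp_t) (A : finPOrderType d) (C : finPOrderType e).
Variables (S : {set A}) (T : {set C}) (a : A) (g c : C).
Hypotheses (a_in : a \in S) (a_bot : forall b, b \in S -> (a <= b)%O).
Hypotheses (g_in : g \in T) (g_bot : forall t, t \in T -> (g <= t)%O).
Hypotheses (c_in : c \in T) (c_top : forall t, t \in T -> (t <= c)%O).
Hypothesis gc : g != c.

Lemma lt_cone_Some (x y : A) : ((Some x : cone A) < (Some y : cone A))%O = (x < y)%O.
Proof. by rewrite !lt_neqAle. Qed.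

(** Moves the mass r from the top c to the bottom g. *)
Definition transfer (v : {ffun C -> K}) (r : K) : {ffun C -> K} :=
  [ffun t => v t + r * ((t == g)%:R - (t == c)%:R)].

Lemma transfer_g v r : transfer v r g = v g + r.
Proof. by rewrite ffunE eqxx (negPf gc) subr0 mulr1. Qed.

Lemma transfer_c v r : transfer v r c = v c - r.
Proof. by rewrite ffunE eqxx [c == g]eq_sym (negPf gc) sub0r mulrN1. Qed.

Lemma transfer_other v r t : t != g -> t != c -> transfer v r t = v t.
Proof. by move=> /negPf tg /negPf tc; rewrite ffunE tg tc subrr mulr0 addr0. Qed.

Lemma realization_transfer v r : geom T v -> 0 <= v g + r -> 0 <= v c - r ->
  geom T (transfer v r).
Proof.
move=> [v0 v1 vT vc] rg rc.
have H t : transfer v r t != 0 -> t \in T /\ [\/ t = g, t = c | v t != 0].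
  have [->|tg] := eqVneq t g; first by split=> //; constructor 1.
  have [->|tc] := eqVneq t c; first by split=> //; constructor 2.
  by rewrite transfer_other // => vt; split; [apply: vT|constructor 3].
split.
- move=> t; have [->|tg] := eqVneq t g; first by rewrite transfer_g.
  have [->|tc] := eqVneq t c; first by rewrite transfer_c.
  by rewrite transfer_other.
- under eq_bigr do rewrite ffunE.
  rewrite big_split /= v1 -mulr_sumr sumrB.
  by rewrite !sum_pred1 subrr mulr0 addr0.
- by move=> t /H[].
- move=> t t' /H[tT ht] /H[tT' ht'].
  case: ht => [->|->|ht]; first by rewrite /Order.comparable g_bot.
    by rewrite /Order.comparable (c_top tT') orbT.
  case: ht' => [->|->|ht']; last exact: vc.
    by rewrite /Order.comparable (g_bot tT) orbT.
  by rewrite /Order.comparable c_top.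
Qed.

(** * The homeomorphism on pairs of marginals *)

Definition fwd1 (u : {ffun A -> K}) (v : {ffun C -> K}) : {ffun cone A -> K} :=
  [ffun q : cone A => if q is Some x then
     squeeze (u a) (v c) (le_mass u x) - squeeze (u a) (v c) (lt_mass u x)
   else v c - shift_amount (u a) (v c)].
Definition fwd2 (u : {ffun A -> K}) (v : {ffun C -> K}) : {ffun C -> K} :=
  transfer v (shift_amount (u a) (v c)).

(** The mass of a before squeezing *)
Definition bwd_mass (u : {ffun cone A -> K}) (v : {ffun C -> K}) : K :=
  u (Some a) + v c - Num.min (v c) (v g).
Definition bwd1 (u : {ffun cone A -> K}) (v : {ffun C -> K}) : {ffun A -> K} :=
  [ffun x => stretch (bwd_mass u v) (v c) (le_mass u (Some x))
     - stretch (bwd_mass u v) (v c) (lt_mass u (Some x))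
     + (x == a)%:R * stretch (bwd_mass u v) (v c) 0].
Definition bwd2 (u : {ffun cone A -> K}) (v : {ffun C -> K}) : {ffun C -> K} :=
  transfer v (- Num.min (v c) (v g)).

Let Some_bot q : q \in cone_set S -> ((Some a : cone A) <= q)%O.
Proof. by case: q => // b; rewrite cone_set_Some => /a_bot. Qed.

Section Forward.
Variables (u : {ffun A -> K}) (v : {ffun C -> K}).
Hypotheses (Su : geom S u) (Tv : geom T v) (uv : Num.min (u a) (v g) = 0).

Let m0 : 0 <= u a. Proof. by case: Su. Qed.
Let s0 : 0 <= v c. Proof. by case: Tv. Qed.
Let s1 : v c <= 1.
Proof. by have := mass_le1 Tv (pred1 c); rewrite big_pred1_eq. Qed.

Lemma fwd1_0 x : u x = 0 -> fwd1 u v (Some x) = 0.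
Proof. by move=> ux; rewrite ffunE le_massE ux addr0 subrr. Qed.

Lemma le_mass_fwd1 x : le_mass (fwd1 u v) (Some x) = squeeze (u a) (v c) (le_mass u x).
Proof.
rewrite /le_mass sum_cone /= add0r; under eq_bigr do rewrite ffunE.
by rewrite (telescope_le Su) squeeze0 // subr0.
Qed.

Lemma lt_mass_fwd1 x : lt_mass (fwd1 u v) (Some x) = squeeze (u a) (v c) (lt_mass u x).
Proof.
rewrite /lt_mass sum_cone /= add0r (eq_bigl _ _ (lt_cone_Some ^~ x)).
under eq_bigr do rewrite ffunE.
by rewrite (telescope_lt Su) squeeze0 // subr0.
Qed.

Lemma realization_fwd1 : geom (cone_set S) (fwd1 u v).
Proof.
have N x : fwd1 u v (Some x) != 0 -> u x != 0 by apply: contraNneq => /fwd1_0 ->.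
case: (Su) => u0 u1 uS uc; split.
- case=> [x|]; rewrite ffunE subr_ge0; last exact: shift_amount_le.
  exact/squeeze_le/(lt_mass_le Su).
- rewrite (sum_cone _ xpredT) /= ffunE; under eq_bigr do rewrite ffunE.
  by rewrite (telescope_all Su) squeeze0 // squeeze1 ?s0 //; lra.
- case=> [x /N /uS|_]; last exact: cone_set_None.
  by rewrite cone_set_Some.
- by move=> [x|] [y|] hx hy; rewrite cone_comparable //; apply: uc; apply: N.
Qed.

Lemma realization_fwd2 : geom T (fwd2 u v).
Proof.
apply: realization_transfer => //; last by rewrite subr_ge0 shift_amount_le.
by rewrite addr_ge0 ?shift_amount_ge0 //; case: Tv.
Qed.

Lemma fwd_top : fwd1 u v None = fwd2 u v c.
Proof. by rewrite transfer_c ffunE. Qed.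

Lemma fwd_bot : fwd1 u v (Some a) = squeeze (u a) (v c) (u a).
Proof. by rewrite ffunE (le_mass_bot Su) // (lt_mass_bot Su) // squeeze0 // subr0. Qed.

Lemma fwd_min : Num.min (fwd1 u v (Some a)) (fwd2 u v g) = 0.
Proof. by rewrite fwd_bot transfer_g; apply: squeeze_min. Qed.

Lemma bwd_mass_fwd : bwd_mass (fwd1 u v) (fwd2 u v) = u a.
Proof.
by rewrite /bwd_mass fwd_bot transfer_c transfer_g shift_amountK // squeeze_bot.
Qed.

(** Above a, le_mass u and lt_mass u take values in [u a, 1], where stretch is a left
    inverse of squeeze. *)
Lemma bwd_fwd1 : bwd1 (fwd1 u v) (fwd2 u v) = u.
Proof.
apply/ffunP => x; rewrite ffunE le_mass_fwd1 lt_mass_fwd1 bwd_mass_fwd transfer_c.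
have [xS|xS] := boolP (x \in S); last first.
  have ux : u x = 0 := realization_out Su xS.
  have xa : x == a = false by apply: contraNF xS => /eqP ->.
  by rewrite le_massE ux addr0 subrr xa mul0r addr0.
have [->|xa] := eqVneq x a.
  rewrite (le_mass_bot Su) // (lt_mass_bot Su) // squeezeK ?m0 ?lexx // squeeze0 //.
  by rewrite mul1r subrK.
have ax : (a < x)%O by rewrite lt_neqAle eq_sym xa a_bot.
have le1 : u a <= lt_mass u x by rewrite -(le_mass_bot Su a_bot) (le_mass_lt Su).
rewrite !squeezeK ?m0 //=; last exact: le_trans le1 (lt_mass_le Su x).
by rewrite le_massE; lra.
Qed.

Lemma bwd_fwd2 : bwd2 (fwd1 u v) (fwd2 u v) = v.
Proof.
rewrite /bwd2 transfer_c transfer_g shift_amountK //.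
by apply/ffunP => t; rewrite !ffunE mulNr addrK.
Qed.

Lemma fwd_id : v c = 0 ->
  (forall x, le_mass (fwd1 u v) (Some x) = le_mass u x /\
             lt_mass (fwd1 u v) (Some x) = lt_mass u x) /\ fwd2 u v = v.
Proof.
move=> vc; split=> [x|].
  rewrite le_mass_fwd1 lt_mass_fwd1 vc !squeeze_id //; first exact: (lt_mass_ge0 Su).
  exact: (le_mass_ge0 Su).
rewrite /fwd2 vc; have -> : shift_amount (u a) 0 = 0 by move: m0; minmax.
by apply/ffunP => t; rewrite ffunE mul0r addr0.
Qed.

End Forward.

Section Backward.
Variables (u : {ffun cone A -> K}) (v : {ffun C -> K}).
Hypotheses (Cu : geom (cone_set S) u) (Tv : geom T v) (top : u None = v c)
  (uv : Num.min (u (Some a)) (v g) = 0).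

Let n0 : 0 <= u (Some a). Proof. by case: Cu. Qed.
Let s0 : 0 <= v c. Proof. by case: Tv. Qed.
Let g0 : 0 <= v g. Proof. by case: Tv. Qed.
Let sg1 : v c + v g <= 1.
Proof.
have := mass_le1 Tv (pred2 c g).
rewrite (bigD1 c) /= ?inE ?eqxx // (bigD1 g) /= ?inE ?eqxx ?orbT ?gc // addrA.
by apply: le_trans; rewrite lerDl sumr_ge0 // => t _; case: Tv.
Qed.

Local Notation m := (bwd_mass u v).
Local Notation k := (stretch m (v c)).

Lemma bwd1_0 x : x != a -> u (Some x) = 0 -> bwd1 u v x = 0.
Proof. by move=> /negPf xa ux; rewrite ffunE xa mul0r addr0 le_massE ux addr0 subrr. Qed.

Lemma lt_mass_None : lt_mass u None = 1 - v c.
Proof.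
case: (Cu) => _ + _ _; rewrite /lt_mass !sum_cone /= add0r top.
move=> <-; rewrite [v c + _]addrC addrK; apply: eq_bigl => x.
by rewrite lt_neqAle.
Qed.

Lemma le_mass_None : le_mass u None = 1.
Proof. by rewrite le_massE lt_mass_None top subrK. Qed.

Lemma bwd1_bot : bwd1 u v a = m.
Proof.
rewrite ffunE eqxx mul1r (lt_mass_bot Cu) // (le_mass_bot Cu) // subrK.
exact: stretch_bot.
Qed.

Lemma realization_bwd1 : geom S (bwd1 u v).
Proof.
have N x : bwd1 u v x != 0 -> x \in S /\ (x = a \/ u (Some x) != 0).
  have [->|xa] := eqVneq x a; first by split=> //; left.
  move=> h; have ux : u (Some x) != 0 by apply: contraNneq h => /(bwd1_0 xa) ->.
  by split; [rewrite -cone_set_Some; case: Cu => _ _ H _; apply: H|right].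
split.
- move=> x; rewrite ffunE addr_ge0 ?mulr_ge0 ?ler0n ?stretch0_ge0 // subr_ge0.
  exact/stretch_le/(lt_mass_le Cu).
- under eq_bigr do rewrite ffunE.
  rewrite big_split /= -mulr_suml.
  rewrite sum_pred1 mul1r.
  have := telescope_all Cu k; rewrite (sum_cone _ xpredT) /=.
  rewrite le_mass_None lt_mass_None; rewrite {2}/bwd_mass stretch1 //; lra.
- by move=> x /N[].
- move=> x y /N[xS hx] /N[yS hy].
  case: hx => [->|hx]; first by rewrite /Order.comparable a_bot.
  case: hy => [->|hy]; first by rewrite /Order.comparable (a_bot xS) orbT.
  by case: Cu => _ _ _ /(_ _ _ hx hy).
Qed.

Lemma realization_bwd2 : geom T (bwd2 u v).
Proof.
apply: realization_transfer => //; rewrite ?opprK; last by rewrite addr_ge0 // le_min s0.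
by rewrite subr_ge0 ge_min lexx orbT.
Qed.

Lemma bwd_min : Num.min (bwd1 u v a) (bwd2 u v g) = 0.
Proof. by rewrite bwd1_bot transfer_g; apply: stretch_min. Qed.

Lemma le_mass_bwd1 x : (a <= x)%O -> le_mass (bwd1 u v) x = k (le_mass u (Some x)).
Proof.
move=> ax; rewrite {1}/le_mass; under eq_bigr do rewrite ffunE.
rewrite big_split /= [X in _ + X](bigD1 a) //= eqxx mul1r [X in _ + (_ + X)]big1; last first.
  by move=> y /andP[_ /negPf ->]; rewrite mul0r.
have := telescope_le Cu k (Some x); rewrite sum_cone /= add0r => H.
rewrite addr0 -[RHS](subrK (k 0)) -H; congr (_ + _).
Qed.

Lemma lt_mass_bwd1 x : (a < x)%O -> lt_mass (bwd1 u v) x = k (lt_mass u (Some x)).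
Proof.
move=> ax; rewrite {1}/lt_mass; under eq_bigr do rewrite ffunE.
rewrite big_split /= [X in _ + X](bigD1 a) //= eqxx mul1r [X in _ + (_ + X)]big1; last first.
  by move=> y /andP[_ /negPf ->]; rewrite mul0r.
have := telescope_lt Cu k (Some x); rewrite sum_cone /= add0r.
rewrite (eq_bigl _ _ (lt_cone_Some ^~ x)) => H.
rewrite addr0 -[RHS](subrK (k 0)) -H; congr (_ + _).
Qed.

Lemma fwd_bwd2 : fwd2 (bwd1 u v) (bwd2 u v) = v.
Proof.
rewrite /fwd2 bwd1_bot transfer_c opprK shift_amount_stretch //.
by apply/ffunP => t; rewrite !ffunE mulNr subrK.
Qed.

Lemma fwd_bwd1 : fwd1 (bwd1 u v) (bwd2 u v) = u.
Proof.
have Sb := realization_bwd1.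
apply/ffunP => -[x|]; rewrite ffunE bwd1_bot transfer_c opprK; last first.
  by rewrite shift_amount_stretch // addrK top.
have [xS|xS] := boolP (x \in S); last first.
  have -> : u (Some x) = 0 by apply: realization_out Cu _; rewrite cone_set_Some.
  by rewrite le_massE (realization_out Sb xS) addr0 subrr.
rewrite le_mass_bwd1 ?a_bot // stretchK //; last exact: (le_mass_ge0 Cu).
have [->|xa] := eqVneq x a.
  by rewrite (lt_mass_bot Sb) // (le_mass_bot Cu) // squeeze_start // subr0.
rewrite lt_mass_bwd1; last by rewrite lt_neqAle eq_sym xa a_bot.
rewrite stretchK //; last exact: (lt_mass_ge0 Cu).
by rewrite le_massE; lra.
Qed.

End Backward.

(** * The homeomorphism on realizations *)

Let W := pset S T :\ (a, g).
Let W0 := [set p in W | p.2 != c].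
(** The poset C W0, embedded in the product of C S with T. *)
Let V := [set q : cone A *p C |
  if q.1 is Some x then (x, q.2) \in W0 else q.2 == c].

Lemma mass_top v : geom T v -> le_mass v c = 1 /\ lt_mass v c = 1 - v c.
Proof.
move=> Tv; have le1 : le_mass v c = 1.
  case: (Tv) => _ <- vT _; rewrite (sum_supp (p := fun t => (t <= c)%O)) //.
  by move=> t /vT /c_top.
by split=> //; rewrite -le1 le_massE addrK.
Qed.

(** The last intervals of both partitions of [0, 1] coincide when the tops carry
    the same mass, so the tops are only coupled to each other. *)
Lemma coupling_top u v q : geom (cone_set S) u -> geom T v -> u None = v c ->
  coupling u v q != 0 -> (q.1 == None) = (q.2 == c).
Proof.
move=> Cu Tv uv /[dup] q0 /(coupling_neq0 Cu Tv)[uq vq].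
have qT : q.2 \in T by case: Tv => _ _ H _; apply: H.
have [lv1 lv2] := mass_top Tv.
apply/idP/idP => [/eqP q1|/eqP q2].
  apply: contraNT q0 => q2.
  have lt2 : (q.2 < c)%O by rewrite lt_neqAle q2 c_top.
  have := le_mass_lt Tv lt2; rewrite lv2 => h.
  rewrite ffunE q1 (lt_mass_None Cu uv) (le_mass_None Cu uv); apply/eqP.
  have := lt_mass_le Tv q.2; have := lt_mass_ge0 Tv q.2; move: h.
  by rewrite /overlap; minmax.
apply: contraNT q0; case eq1: q.1 => [x|] // _.
have lt2 : ((Some x : cone A) < None)%O by rewrite lt_neqAle.
have := le_mass_lt Cu lt2; rewrite (lt_mass_None Cu uv) => h.
rewrite ffunE eq1 q2 lv1 lv2; apply/eqP.
have := lt_mass_le Cu (Some x); have := lt_mass_ge0 Cu (Some x); move: h.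
by rewrite /overlap; minmax.
Qed.

Lemma realization_WP x : geom W x <->
  geom (pset S T) x /\ Num.min (marg1 x a) (marg2 x g) = 0.
Proof.
split=> [Wx|[Sx xN]].
  have STx : geom (pset S T) x by apply: realization_sub Wx; apply: finset.subsetDl.
  split=> //; rewrite -(coupling_bot (realization_marg1 STx) (realization_marg2 STx)) //.
  by rewrite (coupling_marg STx); apply: realization_out Wx _; rewrite !inE eqxx.
apply: (realization_intro Sx) => p xp; rewrite in_setD1.
case: (Sx) => _ _ -> // _; rewrite andbT; apply: contraNneq xp => ->.
by rewrite -(coupling_marg Sx) (coupling_bot (realization_marg1 Sx) (realization_marg2 Sx)) // xN.
Qed.

Lemma realization_VP y : geom V y <-> [/\ geom (pset (cone_set S) T) y,
  marg1 y None = marg2 y c & Num.min (marg1 y (Some a)) (marg2 y g) = 0].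
Proof.
split=> [Vy|[CTy top bot]].
  have CTy : geom (pset (cone_set S) T) y.
    apply: realization_sub Vy; apply/fintype.subsetP => -[[x|] t]; rewrite inE /=.
      rewrite inE in_setD1 [X in _ && X && _]inE => /andP[/and3P[_ xS tT] _].
      by rewrite inE /= cone_set_Some xS.
    by move=> /eqP ->; rewrite inE /= cone_set_None.
  have yV q : q \notin V -> y q = 0 by apply: realization_out Vy.
  split=> //.
    rewrite !ffunE (bigD1 c) //= [RHS](bigD1 None) //= !big1 //.
      by case=> // x _; apply: yV; rewrite inE /= inE /= eqxx andbF.
    by move=> t tc; apply: yV; rewrite inE /=.
  rewrite -(coupling_bot (realization_marg1 CTy) (realization_marg2 CTy)) //.
  by rewrite (coupling_marg CTy); apply: yV; rewrite inE /= inE /= in_setD1 eqxx.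
have y1 := realization_marg1 CTy; have y2 := realization_marg2 CTy.
apply: (realization_intro CTy) => -[z t] yq.
have := yq; rewrite -{1}(coupling_marg CTy) => cq.
have := coupling_top y1 y2 top cq; rewrite inE /=.
case: z yq cq => [x|] yq cq /= tc; last by rewrite -tc.
rewrite inE -tc andbT in_setD1 [X in _ && X]inE /=.
have : ((Some x, t) : cone A *p C) \in pset (cone_set S) T by case: CTy => _ _ ->.
rewrite inE /= cone_set_Some => ->; rewrite andbT.
apply: contraNneq cq => -[-> ->].
by rewrite (coupling_bot y1 y2) // bot.
Qed.

Definition fwd (x : {ffun A *p C -> K}) : {ffun cone A *p C -> K} :=
  coupling (fwd1 (marg1 x) (marg2 x)) (fwd2 (marg1 x) (marg2 x)).
Definition bwd (y : {ffun cone A *p C -> K}) : {ffun A *p C -> K} :=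
  coupling (bwd1 (marg1 y) (marg2 y)) (bwd2 (marg1 y) (marg2 y)).

Lemma piecewise_linear_fwd : piecewise_linear (geom W) fwd.
Proof.
have pX := polyhedron_realization K W.
have p1 b : pl_fun (geom W) (fun x => marg1 x b).
  by apply: pl_fun_affine => //; apply: affine_marg1.
have p2 t : pl_fun (geom W) (fun x => marg2 x t).
  by apply: pl_fun_affine => //; apply: affine_marg2.
have ps : pl_fun (geom W) (fun x => shift_amount (marg1 x a) (marg2 x c)).
  apply/pl_fun_scale/pl_fun_max; first exact: pl_fun_cst.
  by apply: pl_fun_add => //; apply: pl_fun_opp.
have pq z : pl_fun (geom W) z ->
    pl_fun (geom W) (fun x => squeeze (marg1 x a) (marg2 x c) (z x)).
  move=> pz; apply: pl_fun_max; first exact: pl_fun_cst.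
  apply: pl_fun_max; first by apply/pl_fun_scale/pl_fun_add => //; apply: pl_fun_opp.
  by apply: pl_fun_add => //; apply/pl_fun_opp/pl_fun_add => //; apply: pl_fun_opp.
apply: pl_coupling => // [[b|]|t].
- apply: pl_fun_ext (pl_fun_add (pq _ (pl_fun_le_mass b pX p1))
    (pl_fun_opp (pq _ (pl_fun_lt_mass b pX p1)))) => x _.
  by rewrite [RHS]ffunE.
- apply: pl_fun_ext (pl_fun_add (p2 c) (pl_fun_opp ps)) => x _.
  by rewrite [RHS]ffunE.
- apply: pl_fun_ext (pl_fun_add (p2 t) (pl_fun_scale ((t == g)%:R - (t == c)%:R) ps)) => x _.
  by rewrite [RHS]ffunE [in RHS]mulrC.
Qed.

Lemma piecewise_linear_bwd : piecewise_linear (geom V) bwd.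
Proof.
have pX := polyhedron_realization K V.
have p1 b : pl_fun (geom V) (fun x => marg1 x b).
  by apply: pl_fun_affine => //; apply: affine_marg1.
have p2 t : pl_fun (geom V) (fun x => marg2 x t).
  by apply: pl_fun_affine => //; apply: affine_marg2.
have pm : pl_fun (geom V) (fun y => bwd_mass (marg1 y) (marg2 y)).
  by apply: pl_fun_add; [apply: pl_fun_add|apply/pl_fun_opp/pl_fun_min].
have pq z : pl_fun (geom V) z ->
    pl_fun (geom V) (fun y => stretch (bwd_mass (marg1 y) (marg2 y)) (marg2 y c) (z y)).
  by move=> pz; apply: pl_fun_min; apply: pl_fun_add => //; apply: pl_fun_scale.
apply: pl_coupling => // [b|t].
- have h1 := pl_fun_le_mass (Some b : cone A) pX p1; have h2 := pl_fun_lt_mass (Some b : cone A) pX p1.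
  apply: pl_fun_ext (pl_fun_add (pl_fun_add (pq _ h1) (pl_fun_opp (pq _ h2)))
    (pl_fun_scale (b == a)%:R (pq _ (pl_fun_cst 0 pX)))) => y _.
  by rewrite [RHS]ffunE.
- apply: pl_fun_ext (pl_fun_add (p2 t) (pl_fun_scale ((t == g)%:R - (t == c)%:R)
    (pl_fun_opp (pl_fun_min (p2 c) (p2 g))))) => y _.
  by rewrite [RHS]ffunE [in RHS]mulrC.
Qed.

Lemma fwd_homeo : pl_homeo (geom W) (geom V) fwd bwd.
Proof.
split; [| |exact: piecewise_linear_fwd|exact: piecewise_linear_bwd].
- move=> x /realization_WP[STx uv].
  have x1 := realization_marg1 STx; have x2 := realization_marg2 STx.
  have h1 := realization_fwd1 x1 x2; have h2 := realization_fwd2 x1 x2.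
  have m1 : marg1 (fwd x) = _ := marg1_coupling h1 h2.
  have m2 : marg2 (fwd x) = _ := marg2_coupling h1 h2.
  split.
    apply/realization_VP; split; first exact: realization_coupling.
      by rewrite m1 m2 fwd_top.
    by rewrite m1 m2 fwd_min.
  by rewrite /bwd m1 m2 bwd_fwd1 // bwd_fwd2 // (coupling_marg STx).
- move=> y /realization_VP[CTy top uv].
  have y1 := realization_marg1 CTy; have y2 := realization_marg2 CTy.
  have h1 := realization_bwd1 y1 y2 top uv; have h2 := realization_bwd2 (marg1 y) y2.
  have m1 : marg1 (bwd y) = _ := marg1_coupling h1 h2.
  have m2 : marg2 (bwd y) = _ := marg2_coupling h1 h2.
  split.
    apply/realization_WP; rewrite m1 m2 bwd_min //; split=> //.
    exact: realization_coupling.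
  by rewrite /fwd m1 m2 fwd_bwd1 // fwd_bwd2 // (coupling_marg CTy).
Qed.

Let i (q : cone A *p C) : cone (A *p C) :=
  if q.1 is Some x then Some ((x, q.2) : A *p C) else None.

Let i_inj : {in V &, injective i}.
Proof.
move=> [[x|] t] [[y|] s]; rewrite !inE /= /i //=.
  by move=> _ _ [-> ->].
by move=> /eqP -> /eqP ->.
Qed.

Let i_comp : {in V &, forall p q, (i p >=< i q)%O = (p >=< q)%O}.
Proof.
have top x t t' : ((Some x, t) : cone A *p C) \in V -> ((None, t') : cone A *p C) \in V ->
    (((Some x, t) : cone A *p C) <= (None, t'))%O.
  move=> pV; rewrite inE /= => /eqP ->; rewrite leEprod /= c_top //.
  move: pV; rewrite inE /= inE in_setD1 [X in _ && X && _]inE.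
  by move=> /andP[/and3P[_ _ tT] _].
move=> [[x|] t] [[y|] s] pV qV; rewrite cone_comparable /i /=.
- by rewrite /Order.comparable !leEprod.
- by rewrite /Order.comparable top.
- by rewrite /Order.comparable (top _ _ _ qV pV) orbT.
- by move: pV qV; rewrite !inE /= => /eqP -> /eqP ->; rewrite comparablexx.
Qed.

Let i_image : i @: V = cone_set W0.
Proof.
apply/setP => q; apply/imsetP/idP => [[[[x|] t] pV ->]|].
- by rewrite /i cone_set_Some; move: pV; rewrite inE.
- exact: cone_set_None.
case: q => [[x t]|_].
  by rewrite cone_set_Some => pW; exists (Some x, t) => //; rewrite inE.
by exists (None, c) => //; rewrite inE /=.
Qed.

(** In C S x T the elements of W0 and (None, c) form the cone over W0, and fwd is a
    homeomorphism onto its realization that fixes the points with no mass at c. *)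
Lemma homeo_to_cone_bottom :
  homeo_to_cone K (pset S T :\ (a, g)) [set p in pset S T :\ (a, g) | p.2 != c].
Proof.
have VC : pl_homeo (geom V) (geom (cone_set W0)) (push V i) (pull V i).
  by rewrite -i_image; apply: realization_iso.
apply: (homeo_to_cone_intro (pl_homeo_comp fwd_homeo VC)) => x W0x.
have Wx : geom W x.
  by apply: realization_sub W0x; apply/fintype.subsetP => p; rewrite inE => /andP[].
have xc : marg2 x c = 0.
  rewrite ffunE big1 // => b _; apply: realization_out W0x _.
  by rewrite inE eqxx andbF.
have /realization_WP[STx uv] := Wx.
have x1 := realization_marg1 STx; have x2 := realization_marg2 STx.
have [masses f2] := fwd_id x1 x2 xc.
apply: push_incl => //.
- move=> [[y|] t] _; rewrite /i /= ffunE /= f2.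
    by have [-> ->] := masses y; rewrite -[in RHS](coupling_marg STx) ffunE.
  apply/eqP; apply: contraT.
  rewrite -[X in X != 0](ffunE (fun p => overlap (lt_mass (fwd1 (marg1 x) (marg2 x)) p.1)
    (le_mass (fwd1 (marg1 x) (marg2 x)) p.1) (lt_mass (marg2 x) p.2) (le_mass (marg2 x) p.2)) (None, t)).
  move=> /(coupling_neq0 (realization_fwd1 x1 x2) x2)[/=].
  by rewrite fwd_top f2 xc eqxx.
- by move=> q xq; rewrite i_image cone_set_Some; case: W0x => _ _ ->.
Qed.

End BottomProduct.

(** * Stars and order isomorphisms *)

Local Notation down := Defs.down.

Section BaseChange.
Variable K : realType.
Local Notation geom S := (@realization K _ _ S%SET).

Lemma lt_prodE d d' (A : porderType d) (C : porderType d') (p q : A *p C) :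
  (p < q)%O = [&& (p.1 <= q.1)%O, (p.2 <= q.2)%O & q != p].
Proof. by rewrite lt_def leEprod andbC andbA. Qed.

Section BottomCone.
Context (d : Order.disp_t) (A : finPOrderType d).
Variables (a : A) (E D : {set A}).
Variables (F : {ffun A -> K} -> {ffun cone A -> K}) (G : {ffun cone A -> K} -> {ffun A -> K}).
Hypotheses (a_bot : forall x, x \in E -> (a < x)%O) (DE : D \subset E).
Hypotheses (FG : pl_homeo (geom E) (geom (cone_set D)) F G)
  (F_rel : forall x, geom D x -> F x = cone_incl x).

Let i (q : cone A) : A := odflt a q.
Let j (q : cone (cone A)) : cone A := odflt (Some a) q.

Let aE : a \notin E.
Proof. by apply/negP => /a_bot; rewrite ltxx. Qed.

Let aD : a \notin D.
Proof. by apply: contraNN aE => /(fintype.subsetP DE). Qed.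

Let i_inj : {in cone_set E &, injective i}.
Proof.
move=> [x|] [y|]; rewrite ?cone_set_Some /i /= => // xE yE; first by move->.
  by move=> xa; move: aE; rewrite -xa xE.
by move=> ay; move: aE; rewrite ay yE.
Qed.

Let i_comp : {in cone_set E &, forall p q, (i p >=< i q)%O = (p >=< q)%O}.
Proof.
move=> [x|] [y|]; rewrite ?cone_set_Some cone_comparable /i /= => // xE yE.
- by rewrite /Order.comparable (ltW (a_bot xE)) orbT.
- by rewrite /Order.comparable (ltW (a_bot yE)).
- by rewrite comparablexx.
Qed.

Let i_image : i @: cone_set E = a |: E.
Proof.
apply/setP => x; rewrite in_setU1; apply/imsetP/predU1P => [[[y|] yE ->]|[->|xE]].
- by right; rewrite -cone_set_Some.
- by left.
- by exists None; rewrite ?cone_set_None.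
- by exists (Some x); rewrite ?cone_set_Some.
Qed.

Let j_inj : {in cone_set (cone_set D) &, injective j}.
Proof.
move=> [x|] [y|]; rewrite ?cone_set_Some /j /= => // xE yE; first by move->.
  by move=> xa; move: aD; rewrite -cone_set_Some -xa xE.
by move=> ay; move: aD; rewrite -cone_set_Some ay yE.
Qed.

Let j_comp : {in cone_set (cone_set D) &, forall p q, (j p >=< j q)%O = (p >=< q)%O}.
Proof.
have ac x : x \in cone_set D -> ((Some a : cone A) <= x)%O.
  by case: x => // x; rewrite cone_set_Some => /(fintype.subsetP DE) /a_bot /ltW.
move=> [x|] [y|]; rewrite ?cone_set_Some [RHS]cone_comparable /j /= => // xE yE.
- by rewrite /Order.comparable (ac _ xE) orbT.
- by rewrite /Order.comparable (ac _ yE).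
- by rewrite comparablexx.
Qed.

Let j_image : j @: cone_set (cone_set D) = cone_set (a |: D).
Proof.
apply/setP => x; apply/imsetP/idP => [[[y|] yE ->]|].
- rewrite cone_set_Some in yE; case: y yE => [y|_]; last exact: cone_set_None.
  by rewrite /j /= !cone_set_Some in_setU1 => ->; rewrite orbT.
- by rewrite cone_set_Some setU11.
case: x => [x|_]; last by exists (Some None); rewrite // cone_set_Some cone_set_None.
rewrite cone_set_Some in_setU1 => /predU1P[->|xD].
  by exists None; rewrite ?cone_set_None.
by exists (Some (Some x)); rewrite // !cone_set_Some.
Qed.

(** The realization of a |: E is the cone over |E| with apex a, although a is a
    bottom and not a top element; the cone over F leaves the coordinate of the
    apex unchanged. *)
Lemma bottom_cone_homeo : exists F' G',
  [/\ pl_homeo (geom (a |: E)) (geom (cone_set (a |: D))) F' G',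
      forall x, geom (a |: D) x -> F' x = cone_incl x
    & forall x, geom (a |: E) x -> F' x (Some a) = x a].
Proof.
have h1 := realization_iso K i_inj i_comp; rewrite i_image in h1.
have h2 := realization_iso K j_inj j_comp; rewrite j_image in h2.
(* The apex of the outer cone in C C D is a, that of the inner one is the
   greatest element of C (a |: D). *)
have h := pl_homeo_comp (pl_homeo_sym h1) (pl_homeo_comp (cone_homeo FG) h2).
eexists _, _; split; first exact: h.
- move=> x Dx /=; set w := pull _ _ x.
  have wD : geom (cone_set D) w.
    have Ex : geom (a |: E) x by apply: realization_sub Dx; apply: finset.setUS.
    have [Ew _] : geom (cone_set E) w /\ push (cone_set E) i w = x.
      by case: h1 => _ /(_ _ Ex).
    apply: (realization_intro Ew) => -[y|]; last by rewrite cone_set_None.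
    rewrite ffunE !cone_set_Some; case: (boolP (y \in E)) => [yE|]; rewrite ?mul1r ?mul0r ?eqxx //.
    rewrite /i /=; case: Dx => _ _ H _ /H; rewrite in_setU1 => /predU1P[ya|//].
    by move: aE; rewrite -ya yE.
  have wN : w None = x a by rewrite ffunE cone_set_None mul1r.
  have wS y : y \in D -> w (Some y) = x y.
    by move=> yD; rewrite ffunE cone_set_Some (fintype.subsetP DE) // mul1r.
  have FE q : cone_map F w (Some q) = if q is Some y then w (Some y) else 0.
    rewrite ffunE; have [e|n1] := eqVneq (w None) 1.
      rewrite e subrr mul0r; case: q => // y.
      by rewrite (realization_cone_apex y wD e).
    rewrite F_rel; last exact: realization_cone_base.
    rewrite [cone_incl _ _]ffunE; case: q => [y|] /=; last by rewrite mulr0.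
    by rewrite [cone_base _ _]ffunE mulrC divfK // subr_eq0 eq_sym.
  apply/ffunP => c; have [/imsetP[q qD ->]|cD] := boolP (c \in j @: cone_set (cone_set D)).
    rewrite (pushE j_inj) // [RHS]ffunE; case: q qD => [q|_]; last by rewrite [LHS]ffunE wN.
    rewrite cone_set_Some FE; case: q => // y; rewrite cone_set_Some; exact: wS.
  rewrite push_out // ffunE; case: c cD => //= y; rewrite j_image cone_set_Some => yD.
  by rewrite (realization_out Dx yD).
- move=> x Ex /=; rewrite -[Some a]/(j None) (pushE j_inj) ?cone_set_None //.
  by rewrite !ffunE cone_set_None mul1r.
Qed.

End BottomCone.

Section Transport.
Context (d d' : Order.disp_t) (X : finPOrderType d) (A : finPOrderType d').
Variables (i : X -> A).
Hypothesis i_mono : {mono i : x y / (x <= y)%O}.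

Let i_inj : injective i.
Proof. exact: inc_inj. Qed.

Let ci (q : cone X) : cone A := omap i q.

Lemma homeo_to_cone_transport (E D : {set X}) : D \subset E ->
  homeo_to_cone K (i @: E) (i @: D) -> homeo_to_cone K E D.
Proof.
move=> DE [F [[G FG] F_rel]].
have c_inj : {in cone_set D &, injective ci}.
  by move=> [x|] [y|] _ _ //= [/i_inj ->].
have c_comp : {in cone_set D &, forall p q, (ci p >=< ci q)%O = (p >=< q)%O}.
  move=> [x|] [y|] _ _; rewrite !cone_comparable //=.
  by rewrite /Order.comparable !i_mono.
have c_image : ci @: cone_set D = cone_set (i @: D).
  apply/setP => q; apply/imsetP/idP => [[[x|] xD ->]|].
  - by rewrite cone_set_Some imset_f // -cone_set_Some.
  - exact: cone_set_None.
  case: q => [q|_]; last by exists None; rewrite ?cone_set_None.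
  by rewrite cone_set_Some => /imsetP[x xD ->]; exists (Some x); rewrite ?cone_set_Some.
have h2 := realization_iso K c_inj c_comp; rewrite c_image in h2.
have h1 : pl_homeo (geom E) (geom (i @: E)) (push E i) (pull E i).
  apply: realization_iso => [x y _ _ /i_inj //|x y _ _].
  by rewrite /Order.comparable !i_mono.
apply: (homeo_to_cone_intro (pl_homeo_comp h1 (pl_homeo_comp FG (pl_homeo_sym h2)))).
have iE : {in E &, injective i} by move=> x y _ _ /i_inj.
move=> x Dx /=; rewrite F_rel.
  apply/ffunP => -[y|]; rewrite !ffunE /= ?mulr0 // -/(push E i x) cone_set_Some.
  have [yD|yD] := boolP (y \in D); last by rewrite mul0r (realization_out Dx yD).
  by rewrite mul1r pushE // (fintype.subsetP DE).
have Ex := realization_sub DE Dx.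
have Px : geom (i @: E) (push E i x) by case: h1 => /(_ _ Ex) [].
apply: (realization_intro Px) => q /push_neq0[y [_ <- xy]].
by rewrite imset_f //; case: Dx => _ _ ->.
Qed.

Lemma imset_lk (E : {set X}) x : i @: lk x E = lk (i x) (i @: E).
Proof.
apply/setP => q; rewrite inE; apply/imsetP/andP => [[y]|[/imsetP[y yE ->]]].
  by rewrite inE => /andP[yE xy] ->; rewrite imset_f // (leW_mono i_mono).
by rewrite (leW_mono i_mono) => xy; exists y; rewrite // inE yE.
Qed.

End Transport.

(** * Base change to a closed subposet of a product *)

(** The map (i1, i2) identifies X with a closed subposet of A x C. *)
Definition closed_embedding d d' e (X : finPOrderType d) (A : finPOrderType d')
    (C : finPOrderType e) (i1 : X -> A) (i2 : X -> C) :=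
  (forall x y, (x <= y)%O = (i1 x <= i1 y)%O && (i2 x <= i2 y)%O) /\
  (forall x a c, (a <= i1 x)%O -> (c <= i2 x)%O -> exists x', i1 x' = a /\ i2 x' = c).

Lemma closed_embeddingC d d' e (X : finPOrderType d) (A : finPOrderType d')
    (C : finPOrderType e) (i1 : X -> A) (i2 : X -> C) :
  closed_embedding i1 i2 -> closed_embedding i2 i1.
Proof.
move=> [H1 H2]; split=> [x y|x a c h1 h2]; first by rewrite H1 andbC.
by have [x' [e1 e2]] := H2 x c a h2 h1; exists x'.
Qed.

Section ClosedBaseChange.
Context (dA dB dC dX dY : Order.disp_t) (A : finPOrderType dA) (B : finPOrderType dB)
  (C : finPOrderType dC) (X : finPOrderType dX) (Y : finPOrderType dY).
Variables (f : A -> B) (i1 : X -> A) (i2 : X -> C) (j1 : Y -> B) (j2 : Y -> C) (g : X -> Y).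
Hypotheses (f_mono : monotone f).
Hypotheses (i_emb : closed_embedding i1 i2) (j_emb : closed_embedding j1 j2).
Hypotheses (g1 : forall x, j1 (g x) = f (i1 x)) (g2 : forall x, j2 (g x) = i2 x).
Hypothesis g_cover : forall a y, f a = j1 y -> exists x, i1 x = a /\ i2 x = j2 y.

Let i (x : X) : A *p C := (i1 x, i2 x).

Let i_mono : {mono i : x y / (x <= y)%O}.
Proof. by move=> x y; rewrite leEprod /= (proj1 i_emb). Qed.

Lemma base_change_monotone : monotone g.
Proof.
by move=> x y; rewrite (proj1 i_emb) (proj1 j_emb) !g1 !g2 => /andP[/f_mono -> ->].
Qed.

Let j_inj y y' : j1 y = j1 y' -> j2 y = j2 y' -> y = y'.
Proof. by move=> e1 e2; apply: le_anti; rewrite !(proj1 j_emb) e1 e2 !lexx. Qed.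

Let down_image (y : Y) : i @: (g @^-1: down y) = pset (f @^-1: down (j1 y)) (down (j2 y)).
Proof.
apply/setP => p; rewrite !inE; apply/imsetP/andP => [[x]|[]].
  by rewrite !inE (proj1 j_emb) g1 g2 => /andP[h1 h2] -> /=.
case: p => a c /= h1 h2; have [y' [e1 e2]] := proj2 j_emb _ _ _ h1 h2.
have [x [ex1 ex2]] := g_cover (esym e1).
exists x; last by rewrite /i ex1 ex2 e2.
by rewrite !inE (proj1 j_emb) g1 g2 ex1 ex2 e2 h1.
Qed.

Let ddown_image (y : Y) : i @: (g @^-1: ddown y) =
  [set p in pset (f @^-1: down (j1 y)) (down (j2 y)) |
    (p.1 \in f @^-1: ddown (j1 y)) || (p.2 != j2 y)].
Proof.
have ltE x : (g x < y)%O = (g x <= y)%O && ((f (i1 x) < j1 y)%O || (i2 x != j2 y)).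
  rewrite lt_neqAle andbC; case: (boolP (g x <= y)%O) => //=.
  rewrite (proj1 j_emb) g1 g2 => /andP[h1 h2].
  rewrite lt_neqAle h1 andbT -negb_and; congr (~~ _).
  apply/eqP/andP => [<-|[/eqP e1 /eqP e2]]; first by rewrite g1 g2.
  by apply: j_inj; rewrite ?g1 ?g2.
apply/setP => p; rewrite inE -down_image; apply/imsetP/andP => [[x]|[/imsetP[x]]].
  by rewrite !inE ltE => /andP[xy h] ->; rewrite imset_f ?inE.
by rewrite !inE => xy -> h; exists x; rewrite // !inE ltE xy.
Qed.

Let ddown_sub (y : Y) : g @^-1: ddown y \subset g @^-1: down y.
Proof. by apply/fintype.subsetP => x; rewrite !inE => /ltW. Qed.

Let f_closed (b : B) : closed_in (f @^-1: ddown b) (f @^-1: down b).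
Proof.
split=> [|a x _]; first by apply/fintype.subsetP => x; rewrite !inE => /ltW.
by rewrite !inE => xb /f_mono ax; apply: le_lt_trans xb.
Qed.

(** The preimages under g of the down-set and of the strict down-set of y are the
    posets of homeo_to_cone_prod with N empty. *)
Lemma base_change_subdivision : subdivision_map K f -> subdivision_map K g.
Proof.
move=> [_ fS]; split=> [|y]; first exact: base_change_monotone.
apply: (homeo_to_cone_transport i_mono (ddown_sub y)); rewrite down_image ddown_image.
have [F [[G FG] F_rel]] := fS (j1 y).
rewrite -[pset _ _]finset.setD0; apply: (homeo_to_cone_prod (F := F) (G := G)) => //.
- by rewrite inE.
- by move=> t; rewrite inE.
- by move=> p; rewrite finset.in_set0.
Qed.

Section Link.
Variables (b : B) (a : A) (c e : C).
Let E := f @^-1: down b.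
Let D := f @^-1: ddown b.
Hypotheses (aE : a \in E) (ec : (e <= c)%O).
Let L := lk ((a, e) : A *p C) (pset E (down c)).
Let L0 := lk ((a, e) : A *p C) [set p in pset E (down c) | (p.1 \in D) || (p.2 != c)].
Let T := [set t | (e <= t <= c)%O].

Let starE x : (x \in a |: lk a E) = (x \in E) && (a <= x)%O.
Proof.
rewrite in_setU1 [x \in lk a E]inE le_eqVlt [a == x]eq_sym; have [->|] := eqVneq x a.
  by rewrite aE.
by [].
Qed.

Let LP x t : ((x, t) \in L) = [&& x \in E, (a <= x)%O, (e <= t)%O, (t <= c)%O & (x, t) != (a, e)].
Proof.
rewrite inE lt_prodE inE /= [t \in _]inE.
by case: (x \in E); case: (a <= x)%O; case: (t <= c)%O; case: (e <= t)%O.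
Qed.

Let L_star : L = pset (a |: lk a E) T :\: [set (a, e) : A *p C].
Proof.
apply/setP => -[x t]; rewrite LP finset.in_setD [_ \in pset _ _]inE starE finset.in_set1 [t \in T]inE /=.
by case: (x \in E); case: (a <= x)%O; case: (t <= c)%O; case: (e <= t)%O;
  rewrite /= ?andbT ?andbF.
Qed.

Let L0E (S0 : {set A}) : (forall p, p \in L -> (p.1 \in S0) = (p.1 \in D)) ->
  L0 = [set p in L | (p.1 \in S0) || (p.2 != c)].
Proof.
move=> H; apply/setP => p; rewrite [RHS]inE [LHS]inE [X in X && _]inE.
have [pL|] := boolP (p \in L).
  by rewrite H //; move: pL; rewrite inE => /andP[-> ->]; rewrite andbT.
by rewrite inE; case: (p \in pset _ _) => //= /negPf ->; rewrite andbF.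
Qed.

(** All elements of the links have the second coordinate c, so homeo_to_cone_prod
    applies to the links of a and the one-point poset c. *)
Lemma link_top : a \in D -> e = c -> homeo_to_cone K (lk a E) (lk a D) ->
  homeo_to_cone K L L0.
Proof.
move=> aD e_c [F [[G FG] F_rel]].
have LE : L = pset (lk a E) [set c] :\: finset.set0.
  apply/setP => -[x t]; rewrite finset.setD0 LP [RHS]inE /= [x \in lk a E]inE.
  rewrite finset.in_set1 xpair_eqE e_c lt_def; have [->|tc] := eqVneq t c.
    by rewrite lexx; case: (x \in E); case: (a <= x)%O; case: (x == a).
  rewrite !andbF; apply: negbTE; apply/negP => /and5P[_ _ h1 h2 _].
  by case/eqP: tc; apply: le_anti; rewrite h1 h2.
rewrite (L0E (S0 := lk a D)); last first.
  move=> p; rewrite LE finset.setD0 inE => /andP[]; rewrite !inE.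
  by move=> /andP[_ ->]; rewrite andbT.
rewrite LE; apply: (homeo_to_cone_prod (F := F) (G := G)) => //.
- split=> [|x y]; first by apply/fintype.subsetP => x; rewrite !inE => /andP[/ltW -> ->].
  rewrite [x \in lk a D]inE [x \in lk a E]inE => /andP[xE ->] /=; rewrite inE andbT => /andP[yD _].
  by apply: (proj2 (f_closed b) _ _ xE yD).
- by rewrite finset.in_set1.
- by move=> t; rewrite finset.in_set1 => /eqP ->.
- by move=> p; rewrite finset.in_set0.
Qed.

(** Here homeo_to_cone_prod is applied to the stars of a in E and D, whose
    homeomorphism preserves the coordinate at a, with the bottom (a, e) removed. *)
Lemma link_face : a \in D -> e != c -> homeo_to_cone K (lk a E) (lk a D) ->
  homeo_to_cone K L L0.
Proof.
move=> aD e_c [F [[G FG] F_rel]].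
have DE : D \subset E by case: (f_closed b).
have lkDE : lk a D \subset lk a E.
  by apply/fintype.subsetP => x; rewrite !inE => /andP[/ltW -> ->].
have a_bot x : x \in lk a E -> (a < x)%O by rewrite inE => /andP[].
have [F' [G' [FG' F_rel' F_bot]]] := bottom_cone_homeo a_bot lkDE FG F_rel.
have S0E x : (x \in a |: lk a D) = (x \in D) && (a <= x)%O.
  rewrite in_setU1 [x \in lk a D]inE le_eqVlt [a == x]eq_sym.
  by have [->|] := eqVneq x a; rewrite ?aD.
rewrite (L0E (S0 := a |: lk a D)); last first.
  by move=> [x t]; rewrite LP S0E /= => /and3P[_ -> _]; rewrite andbT.
rewrite L_star; apply: (homeo_to_cone_prod (F := F') (G := G')) => //.
- split=> [|x y]; first exact: finset.setUS.
  rewrite starE !S0E => /andP[xE ->] /andP[yD _] xy; rewrite andbT.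
  exact: (proj2 (f_closed b) _ _ xE yD xy).
- by rewrite inE ec lexx.
- by move=> t; rewrite inE => /andP[].
- move=> p; rewrite finset.in_set1 => /eqP -> /=; split=> //.
  + exact: setU11.
  + by move=> x; rewrite starE => /andP[].
  + by move=> t; rewrite inE => /andP[].
Qed.

(** All of the link lies off D, so only the elements with second coordinate c are
    missing from the smaller link. *)
Lemma link_outside : a \notin D -> e != c -> homeo_to_cone K L L0.
Proof.
move=> aD e_c; rewrite (L0E (S0 := finset.set0)); last first.
  move=> [x t]; rewrite LP finset.in_set0 /= => /and3P[xE ax _].
  by apply/esym; apply: contraNF aD => xD; apply: (proj2 (f_closed b) _ _ aE xD ax).
have -> : [set p in L | (p.1 \in finset.set0) || (p.2 != c)] = [set p in L | p.2 != c].
  by apply/setP => p; rewrite !inE.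
rewrite L_star; apply: homeo_to_cone_bottom => //.
- exact: setU11.
- by move=> x; rewrite starE => /andP[].
- by rewrite inE lexx ec.
- by move=> t; rewrite inE => /andP[].
- by rewrite inE lexx ec.
- by move=> t; rewrite inE => /andP[].
Qed.

End Link.

Lemma base_change_stratification : stratification_map K f -> stratification_map K g.
Proof.
move=> [_ fS]; split=> [|y]; first exact: base_change_monotone.
split.
  split=> [|x x' _]; first exact: ddown_sub.
  by rewrite !inE => x'y /base_change_monotone xx'; apply: le_lt_trans x'y.
move=> x xD.
have lk_sub : lk x (g @^-1: ddown y) \subset lk x (g @^-1: down y).
  by apply/fintype.subsetP => z; rewrite !inE => /andP[/ltW -> ->].
apply: (homeo_to_cone_transport i_mono lk_sub).
rewrite !(imset_lk i_mono) down_image ddown_image.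
have : i x \in i @: (g @^-1: ddown y) by rewrite imset_f.
rewrite ddown_image inE => /andP[]; rewrite inE => /andP[/= aE]; rewrite inE => ec h.
have [_ fl] := fS (j1 y).
have [aD|aD] := boolP (i1 x \in f @^-1: ddown (j1 y)).
  have [e_c|e_c] := eqVneq (i2 x) (j2 y); first by apply: link_top => //; apply: fl.
  by apply: link_face => //; apply: fl.
by apply: link_outside => //; move: h; rewrite (negPf aD).
Qed.

End ClosedBaseChange.
End BaseChange.

(** * Cubical maps *)

Section DownSet.
Context (d : Order.disp_t) (A : finPOrderType d) (p : A).

Record strict_down : Type := StrictDown { sd_val : A; _ : (sd_val < p)%O }.
HB.instance Definition _ := [isSub for sd_val].
HB.instance Definition _ := [Finite of strict_down by <:].
HB.instance Definition _ := [SubChoice_isSubPOrder of strict_down by <: with d].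

Definition cone_val (x : cone strict_down) : A := if x is Some y then sd_val y else p.

Lemma cone_val_iso : iso_onto cone_val (down p).
Proof.
split.
  move=> [x|] [y|] //.
  - by apply: ltW; case: x.
  - by case: y => y yp; apply: lt_geF.
  - exact: lexx.
move=> y; rewrite inE; split=> [|[x <-]].
  rewrite le_eqVlt => /predU1P[->|yp]; first by exists None.
  by exists (Some (StrictDown yp)).
by case: x => [[x xp]|] //=; apply: ltW.
Qed.

End DownSet.

Section Cubical.
Context (d d' e : Order.disp_t) (X : finPOrderType d) (A : finPOrderType d')
  (C : finPOrderType e).

(** The down-set of x is the product of the down-sets of i1 x and i2 x, and each
    of these is the cone over the strict down-set. *)
Lemma closed_embedding_cubical (i1 : X -> A) (i2 : X -> C) :
  closed_embedding i1 i2 -> cubical i1.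
Proof.
move=> [emb cl]; split=> [x y|x]; first by rewrite emb => /andP[].
exists d', e, (strict_down (i1 x)), (strict_down (i2 x)).
have [mA surA] := cone_val_iso (i1 x); have [mC surC] := cone_val_iso (i2 x).
have H (q : cone (strict_down (i1 x)) *p cone (strict_down (i2 x))) :
    exists x', i1 x' = cone_val q.1 /\ i2 x' = cone_val q.2.
  have h1 : cone_val q.1 \in down (i1 x) by apply/surA; exists q.1.
  have h2 : cone_val q.2 \in down (i2 x) by apply/surC; exists q.2.
  by rewrite !inE in h1 h2; apply: cl h1 h2.
have [al alE] := fin_all_exists H.
exists al, (@cone_val _ _ (i1 x)); split=> //; last by move=> q; case: (alE q).
split.
  move=> q r; have [q1 q2] := alE q; have [r1 r2] := alE r.
  by rewrite emb q1 q2 r1 r2 mA mC leEprod.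
move=> y; rewrite inE; split=> [|[q <-]].
  rewrite emb => /andP[h1 h2].
  have /surA[v ve] : i1 y \in down (i1 x) by rewrite inE.
  have /surC[w we] : i2 y \in down (i2 x) by rewrite inE.
  exists (v, w); have [e1 e2] := alE (v, w).
  by apply: le_anti; rewrite !emb e1 e2 /= ve we !lexx.
have [e1 e2] := alE q; rewrite emb e1 e2.
have h1 : cone_val q.1 \in down (i1 x) by apply/surA; exists q.1.
have h2 : cone_val q.2 \in down (i2 x) by apply/surC; exists q.2.
by rewrite !inE in h1 h2; rewrite h1.
Qed.

End Cubical.

(** * The posets of the diagram *)

Section PullbackOrder.
Context (dA dB dC : Order.disp_t) (A : finPOrderType dA) (B : finPOrderType dB)
  (C : finPOrderType dC) (f : A -> C) (g : B -> C).

Lemma le_pullback (x y : pullback f g) :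
  (x <= y)%O = (pb_fst f g x <= pb_fst f g y)%O && (pb_snd f g x <= pb_snd f g y)%O.
Proof. exact: (leEprod (pb_pair x) (pb_pair y)). Qed.

Lemma pullback_eq (x : pullback f g) : f (pb_fst f g x) = g (pb_snd f g x).
Proof. by apply/eqP; case: x. Qed.

Lemma pullback_intro a b : f a = g b ->
  exists x : pullback f g, pb_fst f g x = a /\ pb_snd f g x = b.
Proof. by move=> /eqP e; exists (@Pullback _ _ _ _ _ _ f g (a, b) e). Qed.

End PullbackOrder.

(** Passing to a smaller element of Q x Q^d lowers the first coordinate and raises
    the second one in Q, so the ends of an interval remain the ends of one. *)
Lemma hposet_embedding d (Q : finPOrderType d) : closed_embedding (@r_ _ Q) (@rbar _ Q).
Proof.
split=> [s t|s a c sa sc]; first exact: itv_leE.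
have ac : (a <= c :> Q)%O by apply: le_trans sa (le_trans (valP s) sc).
by exists (@Defs.Interval _ Q (a, c) ac).
Qed.

Section Diagram.
Context (dP dQ dR : Order.disp_t)
    (P : finPOrderType dP) (Q : finPOrderType dQ) (R : finPOrderType dR)
    (f : P -> Q) (phi : R -> Q^d)
    (f_monotone : monotone f) (phi_monotone : monotone phi).
Local Notation rho_X := (pb_fst f (@r_ _ Q)).
Local Notation g := (pb_snd f (@r_ _ Q)).
Local Notation psi := (pb_fst (@rbar _ Q) phi).
Local Notation rhobar_Y := (pb_snd (@rbar _ Q) phi).
Local Notation chi := (pb_fst g psi).
Local Notation h := (pb_snd g psi).

Let h_emb := hposet_embedding Q.

(** The image of X consists of the pairs (p, t) with f p <= t in Q. *)
Lemma X_embedding : closed_embedding rho_X (@rbar _ Q \o g).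
Proof.
split=> [x y|x a c ax cx].
  rewrite le_pullback (proj1 h_emb) -!pullback_eq /=.
  by have [/f_monotone ->|] := boolP (rho_X x <= rho_X y)%O.
have [s [s1 s2]] : exists s, r_ s = f a /\ rbar s = c.
  by apply: (proj2 h_emb (g x)) => //; rewrite -pullback_eq f_monotone.
have [x' [e1 e2]] := pullback_intro (esym s1).
by exists x'; rewrite /= e2.
Qed.

(** The image of Y consists of the pairs (q, r) with q <= phi r in Q. *)
Lemma Y_embedding : closed_embedding (@r_ _ Q \o psi) rhobar_Y.
Proof.
split=> [x y|x a c ax cx].
  rewrite le_pullback (proj1 h_emb) !pullback_eq /= -andbA.
  by have [/phi_monotone ->|] := boolP (rhobar_Y x <= rhobar_Y y)%O; rewrite ?andbF.
have [s [s1 s2]] : exists s, r_ s = a /\ rbar s = phi c.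
  by apply: (proj2 h_emb (psi x)) => //; rewrite pullback_eq phi_monotone.
have [x' [e1 e2]] := pullback_intro s2.
by exists x'; rewrite /= e1.
Qed.

Lemma rbar_g_chi z : rbar (g (chi z)) = phi (rhobar_Y (h z)).
Proof. by rewrite pullback_eq pullback_eq. Qed.

Lemma r_psi_h z : r_ (psi (h z)) = f (rho_X (chi z)).
Proof. by rewrite -pullback_eq -pullback_eq. Qed.

(** The image of Z consists of the pairs (p, r) with f p <= phi r in Q. *)
Lemma Z_embedding : closed_embedding (rho_X \o chi) (rhobar_Y \o h).
Proof.
split=> [x y|z a c az cz].
  rewrite le_pullback (proj1 X_embedding) (proj1 Y_embedding) /=.
  rewrite !rbar_g_chi !r_psi_h.
  have [/f_monotone ->|//] := boolP (rho_X (chi x) <= rho_X (chi y))%O.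
  by have [/phi_monotone ->|] := boolP (rhobar_Y (h x) <= rhobar_Y (h y))%O; rewrite ?andbF.
have [s [s1 s2]] : exists s, r_ s = f a /\ rbar s = phi c.
  apply: (proj2 h_emb (g (chi z))); first by rewrite -pullback_eq f_monotone.
  by rewrite rbar_g_chi phi_monotone.
have [x [x1 x2]] := pullback_intro (esym s1).
have [y [y1 y2]] := pullback_intro s2.
have [z' [z1 z2]] : exists z' : pullback g psi, chi z' = x /\ h z' = y.
  by apply: pullback_intro; rewrite x2 y1.
by exists z'; rewrite /= z1 z2.
Qed.

End Diagram.

Theorem corollary18p3 (K : realType) (dP dQ dR : Order.disp_t)
    (P : finPOrderType dP) (Q : finPOrderType dQ) (R : finPOrderType dR)
    (f : P -> Q) (phi : R -> Q^d)
    (f_monotone : monotone f) (phi_monotone : monotone phi) :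
  let rho_X := pb_fst f (@r_ _ Q) in
  let g := pb_snd f (@r_ _ Q) in
  let psi := pb_fst (@rbar _ Q) phi in
  let rhobar_Y := pb_snd (@rbar _ Q) phi in
  let chi := pb_fst g psi in
  let h := pb_snd g psi in
  [/\ cubical (@r_ _ Q), cubical (@rbar _ Q), cubical rho_X & cubical rhobar_Y]
  /\ [/\ cubical (rho_X \o chi), cubical (@r_ _ Q \o psi),
         cubical (rhobar_Y \o h) & cubical (@rbar _ Q \o g)]
  /\ (stratification_map K f ->
        stratification_map K g /\ stratification_map K h)
  /\ (subdivision_map K f -> subdivision_map K g /\ subdivision_map K h)
  /\ (stratification_map K phi ->
        stratification_map K psi /\ stratification_map K chi)
  /\ (subdivision_map K phi -> subdivision_map K psi /\ subdivision_map K chi).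
Proof.
move=> rho_X g psi rhobar_Y chi h.
have hQ := hposet_embedding Q; have hQ' := closed_embeddingC hQ.
have hX : closed_embedding rho_X (@rbar _ Q \o g) := X_embedding f_monotone.
have hX' := closed_embeddingC hX.
have hY : closed_embedding (@r_ _ Q \o psi) rhobar_Y := Y_embedding phi_monotone.
have hY' := closed_embeddingC hY.
have hZ : closed_embedding (rho_X \o chi) (rhobar_Y \o h) :=
  Z_embedding f_monotone phi_monotone.
have hZ' := closed_embeddingC hZ.
have g_eq x : r_ (g x) = f (rho_X x) by rewrite -pullback_eq.
have psi_eq y : rbar (psi y) = phi (rhobar_Y y) by rewrite pullback_eq.
have g_cover a s : f a = r_ s -> exists x, rho_X x = a /\ rbar (g x) = rbar s.
  by move=> /pullback_intro[x [e1 e2]]; exists x; rewrite /g e2.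
have psi_cover r s : phi r = rbar s -> exists y, rhobar_Y y = r /\ r_ (psi y) = r_ s.
  by move=> /esym /pullback_intro[y [e1 e2]]; exists y; rewrite /psi e1.
have h_eq z : r_ (psi (h z)) = f (rho_X (chi z)) := r_psi_h z.
have chi_eq z : rbar (g (chi z)) = phi (rhobar_Y (h z)) := rbar_g_chi z.
have h_cover a y : f a = r_ (psi y) ->
    exists z, rho_X (chi z) = a /\ rhobar_Y (h z) = rhobar_Y y.
  move=> /pullback_intro[x [e1 /pullback_intro[z [e2 e3]]]].
  by exists z; rewrite /chi /h e2 e3.
have chi_cover r x : phi r = rbar (g x) ->
    exists z, rhobar_Y (h z) = r /\ rho_X (chi z) = rho_X x.
  move=> /esym /pullback_intro[y [/esym /pullback_intro[z [e2 e3]] e1]].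
  by exists z; rewrite /chi /h e2 e3.
split; first by split; [exact: closed_embedding_cubical hQ|
  exact: closed_embedding_cubical hQ'|exact: closed_embedding_cubical hX|
  exact: closed_embedding_cubical hY'].
split; first by split; [exact: closed_embedding_cubical hZ|
  exact: closed_embedding_cubical hY|exact: closed_embedding_cubical hZ'|
  exact: closed_embedding_cubical hX'].
split=> [fS|]; [|split=> [fS|]; [|split=> phiS]].
- by split; [exact: (base_change_stratification f_monotone hX hQ)|
    exact: (base_change_stratification f_monotone hZ hY)].
- by split; [exact: (base_change_subdivision f_monotone hX hQ)|
    exact: (base_change_subdivision f_monotone hZ hY)].
- by split; [exact: (base_change_stratification phi_monotone hY' hQ')|
    exact: (base_change_stratification phi_monotone hZ' hX')].
- by split; [exact: (base_change_subdivision phi_monotone hY' hQ')|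
    exact: (base_change_subdivision phi_monotone hZ' hX')].
Qed.
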